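(* Let $M$ be an $m$-dimensional Riemannian manifold with $m\ge 3$. Then: (a) If $M$ satisfies the axiom of special $r$-submanifolds for some $2\le r\le m-1$, then $M$ has constant sectional curvature if $r\le m-2$, and $M$ is Einstein if $r=m-1$. (b) If $M$ satisfies the axiom of very special $(m-1)$-submanifolds, then $M$ has constant sectional curvature. Conversely, any isometric immersion in a manifold of constant sectional curvature is very special, and any hypersurface in an Einstein manifold is special.
   Context: For a Riemannian manifold $M$ with Levi-Civita connection $\bar\nabla$, the curvature tensor is $\bar R(X,Y)=\bar\nabla_X\bar\nabla_Y-\bar\nabla_Y\bar\nabla_X-\bar\nabla_{[X,Y]}$. The Ricci bilinear form is given by $-\mathrm{Ric}(w,\eta)=\langle\sum_{i=1}^m\bar R(v_i,w)v_i,\eta\rangle$ for any orthonormal basis $v_1,\dots,v_m$ of $T_pM$, and $M$ is Einstein if $\mathrm{Ric}(v,w)=\rho\langle v,w\rangle$ for some $\rho\in\mathbb{R}$. For an isometric immersion $f:S\to M$, the tangent space $T_pS$ is identified with its image $df_p(T_pS)$ in the tangent space of $M$. A hypersurface is a codimension-one isometric immersion. The immersion $f$ is called special if for every $p\in S$ and every orthonormal basis $v_1,\dots,v_r$ of $T_pS$ one has $\sum_i\bar R(v_i,w)v_i\in T_pS$ for all $w\in T_pS$. The immersion $f$ is called very special if for every $p\in S$ and all $v,w\in T_pS$ one has $\bar R(v,w)v\in T_pS$. A submanifold is special (very special) if its inclusion, with the induced metric, is a special (very special) isometric immersion. Given $M$ of dimension $m\ge 3$ and $2\le r\le m-1$,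 $M$ satisfies the axiom of special (respectively, very special) $r$-submanifolds if for every $p\in M$ and every $r$-dimensional linear subspace $W\subset T_pM$ there exists a special (respectively, very special) submanifold $S$ with $T_pS=W$.
   Formalization: In (a) and (b) the manifold M is assumed connected; without this the claim fails for a single global constant, e.g. for the disjoint union of two round 3-spheres of different radii. *)

(* Defs.v *)
From HB Require Import structures.
From mathcomp Require Import all_boot all_order all_algebra.
From mathcomp Require Import all_classical all_reals all_analysis.

Set Implicit Arguments.
Unset Strict Implicit.
Unset Printing Implicit Defensive.

Import Order.TTheory GRing.Theory Num.Theory.
Import numFieldNormedType.Exports.

Local Open Scope classical_set_scope.
Local Open Scope ring_scope.

(* C^oo on the open set A: every iterated directional derivative exists and is
   Frechet differentiable at every point of A. *)
Definition iter_deriv (R : realType) (V W : normedModType R)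
    (vs : seq V) (f : V -> W) : V -> W :=
  foldr (fun (v : V) (h : V -> W) => fun x => 'D_v h x) f vs.

Definition smooth_on (R : realType) (V W : normedModType R)
    (A : set V) (f : V -> W) : Prop :=
  forall (vs : seq V) (x : V), A x -> differentiable (iter_deriv vs f) x.

(* The smooth structure is given by an atlas indexed by the points of the
   manifold: [chart p] is a chart whose domain contains [p], with inverse
   [chart_inv p].  Any atlas yields one of this form by choosing a chart
   around each point.  The values of [chart p] outside [chart_dom p] and of
   [chart_inv p] outside the image are irrelevant. *)
Record manifold (R : realType) (m : nat) := Manifold {
  carrier :> topologicalType;
  chart_dom : carrier -> set carrier;
  chart : carrier -> carrier -> 'rV[R]_m;
  chart_inv : carrier -> 'rV[R]_m -> carrier;
  manifold_hausdorff : hausdorff_space carrier;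
  manifold_second_countable : @second_countable carrier;
  chart_dom_center : forall p, chart_dom p p;
  chart_dom_open : forall p, open (chart_dom p);
  chart_image_open : forall p, open (chart p @` chart_dom p);
  chartK : forall p q, chart_dom p q -> chart_inv p (chart p q) = q;
  chart_continuous : forall p q, chart_dom p q ->
    {for q, continuous (chart p)};
  chart_inv_continuous : forall p q, chart_dom p q ->
    {for chart p q, continuous (chart_inv p)};
  chart_compat : forall p q,
    smooth_on (chart p @` (chart_dom p `&` chart_dom q))
      (chart q \o chart_inv p) }.

(* A tangent vector at [p] is represented by its components with respect to
   the preferred chart [chart p], so that every tangent space is 'rV[R]_m.
   [chart_change a b q v] is the list of components with respect to [chart b]
   of the vector at [q] whose components with respect to [chart a] are [v]. *)
Definition chart_change (R : realType) (m : nat) (M : manifold R m)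
    (a b q : M) (v : 'rV[R]_m) : 'rV[R]_m :=
  'd (chart b \o chart_inv a) (chart a q) v.

(* A vector field; only its values on a given open set are meaningful. *)
Definition vfield (R : realType) (m : nat) (M : manifold R m) : Type :=
  M -> 'rV[R]_m.

Definition vfield_coord (R : realType) (m : nat) (M : manifold R m)
    (a : M) (X : vfield M) (x : 'rV[R]_m) : 'rV[R]_m :=
  chart_change (chart_inv a x) a (chart_inv a x) (X (chart_inv a x)).

Definition smooth_vfield (R : realType) (m : nat) (M : manifold R m)
    (U : set M) (X : vfield M) : Prop :=
  forall a : M, smooth_on (chart a @` (chart_dom a `&` U)) (vfield_coord a X).

Definition smooth_fun (R : realType) (m : nat) (M : manifold R m)
    (U : set M) (h : M -> R) : Prop :=
  forall a : M, smooth_on (chart a @` (chart_dom a `&` U)) (h \o chart_inv a).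

(* X(h) *)
Definition vderiv (R : realType) (m : nat) (M : manifold R m)
    (X : vfield M) (h : M -> R) : M -> R :=
  fun p => 'd (h \o chart_inv p) (chart p p) (X p).

(* [X, Y]^k = X^i d_i Y^k - Y^i d_i X^k, computed at p in the chart [chart p] *)
Definition lie_bracket (R : realType) (m : nat) (M : manifold R m)
    (X Y : vfield M) : vfield M :=
  fun p => 'd (vfield_coord p Y) (chart p p) (X p)
           - 'd (vfield_coord p X) (chart p p) (Y p).

Definition coord_vfield (R : realType) (m : nat) (M : manifold R m)
    (a : M) (v : 'rV[R]_m) : vfield M :=
  fun q => chart_change a q q v.

Record riemannian (R : realType) (m : nat) := Riemannian {
  riem_manifold :> manifold R m;
  inner : riem_manifold -> 'rV[R]_m -> 'rV[R]_m -> R;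
  inner_linear : forall p (c : R) u v w,
    inner p (c *: u + v) w = c * inner p u w + inner p v w;
  inner_sym : forall p v w, inner p v w = inner p w v;
  inner_pos : forall p v, v != 0 -> 0 < inner p v v;
  inner_smooth : forall (U : set riem_manifold) (X Y : vfield riem_manifold),
    open U -> smooth_vfield U X -> smooth_vfield U Y ->
    smooth_fun U (fun p => inner p (X p) (Y p)) }.

(* Connections act on locally defined vector fields: the axioms are required
   over every open set U, and [connection_local] says that the value on U only
   depends on the restrictions to U.  This is the usual extension of an affine
   connection to local sections. *)
Record is_connection (R : realType) (m : nat) (M : manifold R m)
    (nabla : vfield M -> vfield M -> vfield M) : Prop := IsConnection {
  connection_smooth : forall (U : set M) X Y, open U ->
    smooth_vfield U X -> smooth_vfield U Y -> smooth_vfield U (nabla X Y);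
  connection_local : forall (U : set M) X X' Y Y', open U ->
    smooth_vfield U X -> smooth_vfield U Y ->
    {in U, X =1 X'} -> {in U, Y =1 Y'} ->
    {in U, nabla X Y =1 nabla X' Y'};
  connection_addl : forall (U : set M) X X' Y, open U ->
    smooth_vfield U X -> smooth_vfield U X' -> smooth_vfield U Y ->
    {in U, nabla (fun q => X q + X' q) Y
           =1 (fun p => nabla X Y p + nabla X' Y p)};
  connection_scalel : forall (U : set M) (h : M -> R) X Y, open U ->
    smooth_fun U h -> smooth_vfield U X -> smooth_vfield U Y ->
    {in U, nabla (fun q => h q *: X q) Y =1 (fun p => h p *: nabla X Y p)};
  connection_addr : forall (U : set M) X Y Y', open U ->
    smooth_vfield U X -> smooth_vfield U Y -> smooth_vfield U Y' ->
    {in U, nabla X (fun q => Y q + Y' q)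
           =1 (fun p => nabla X Y p + nabla X Y' p)};
  connection_leibniz : forall (U : set M) (h : M -> R) X Y, open U ->
    smooth_fun U h -> smooth_vfield U X -> smooth_vfield U Y ->
    {in U, nabla X (fun q => h q *: Y q)
           =1 (fun p => vderiv X h p *: Y p + h p *: nabla X Y p)} }.

Record levi_civita (R : realType) (m : nat) (M : riemannian R m)
    (nabla : vfield M -> vfield M -> vfield M) : Prop := LeviCivita {
  levi_civita_connection : is_connection nabla;
  levi_civita_torsion_free : forall (U : set M) X Y, open U ->
    smooth_vfield U X -> smooth_vfield U Y ->
    {in U, (fun p => nabla X Y p - nabla Y X p) =1 lie_bracket X Y};
  levi_civita_metric : forall (U : set M) X Y Z, open U ->
    smooth_vfield U X -> smooth_vfield U Y -> smooth_vfield U Z ->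
    {in U, vderiv X (fun q => inner q (Y q) (Z q))
           =1 (fun p => inner p (nabla X Y p) (Z p)
                        + inner p (Y p) (nabla X Z p))} }.

Definition curvature_vfield (R : realType) (m : nat) (M : manifold R m)
    (nabla : vfield M -> vfield M -> vfield M) (X Y Z : vfield M) : vfield M :=
  fun p => nabla X (nabla Y Z) p - nabla Y (nabla X Z) p
           - nabla (lie_bracket X Y) Z p.

(* R(v, w) u for tangent vectors at p.  The curvature is tensorial, so any
   smooth extensions of v, w, u near p may be used; we take the ones with
   constant components in [chart p]. *)
Definition curv (R : realType) (m : nat) (M : manifold R m)
    (nabla : vfield M -> vfield M -> vfield M) (p : M) (v w u : 'rV[R]_m) :
    'rV[R]_m :=
  curvature_vfield nabla
    (coord_vfield p v) (coord_vfield p w) (coord_vfield p u) p.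

Definition orthonormal_basis (R : realType) (m : nat) (M : riemannian R m)
    (p : M) (e : 'I_m -> 'rV[R]_m) : Prop :=
  forall i j, inner p (e i) (e j) = (i == j)%:R.

Definition sectional_curvature (R : realType) (m : nat) (M : riemannian R m)
    (nabla : vfield M -> vfield M -> vfield M) (p : M) (v w : 'rV[R]_m) : R :=
  inner p (curv nabla p v w w) v
  / (inner p v v * inner p w w - inner p v w ^+ 2).

Definition constant_sectional_curvature (R : realType) (m : nat)
    (M : riemannian R m) (nabla : vfield M -> vfield M -> vfield M) : Prop :=
  exists c : R, forall (p : M) (v w : 'rV[R]_m),
    free [:: v; w] -> sectional_curvature nabla p v w = c.

Definition is_ricci (R : realType) (m : nat) (M : riemannian R m)
    (nabla : vfield M -> vfield M -> vfield M) (p : M)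
    (Ric : 'rV[R]_m -> 'rV[R]_m -> R) : Prop :=
  forall e : 'I_m -> 'rV[R]_m, orthonormal_basis p e ->
  forall w eta : 'rV[R]_m,
    - Ric w eta = inner p (\sum_(i < m) curv nabla p (e i) w (e i)) eta.

Definition einstein (R : realType) (m : nat) (M : riemannian R m)
    (nabla : vfield M -> vfield M -> vfield M) : Prop :=
  exists rho : R, forall p : M,
    is_ricci nabla p (fun v w => rho * inner p v w).

Definition smooth_map (R : realType) (n m : nat)
    (S : manifold R n) (M : manifold R m) (f : S -> M) : Prop :=
  continuous f /\
  forall (b : S) (a : M),
    smooth_on (chart b @` (chart_dom b `&` f @^-1` chart_dom a))
      (chart a \o f \o chart_inv b).

Definition dmap (R : realType) (n m : nat)
    (S : manifold R n) (M : manifold R m) (f : S -> M) (q : S)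
    (v : 'rV[R]_n) : 'rV[R]_m :=
  'd (chart (f q) \o f \o chart_inv q) (chart q q) v.

Definition isometric_immersion (R : realType) (n m : nat)
    (S : riemannian R n) (M : riemannian R m) (f : S -> M) : Prop :=
  [/\ smooth_map f,
      forall q : S, injective (dmap f q) &
      forall (q : S) (v w : 'rV[R]_n),
        inner (f q) (dmap f q v) (dmap f q w) = inner q v w].

Definition special (R : realType) (n m : nat)
    (S : riemannian R n) (M : riemannian R m)
    (nabla : vfield M -> vfield M -> vfield M) (f : S -> M) : Prop :=
  forall (q : S) (e : 'I_n -> 'rV[R]_n), orthonormal_basis q e ->
  forall w : 'rV[R]_n,
    range (dmap f q)
      (\sum_(i < n)
         curv nabla (f q) (dmap f q (e i)) (dmap f q w) (dmap f q (e i))).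

Definition very_special (R : realType) (n m : nat)
    (S : riemannian R n) (M : riemannian R m)
    (nabla : vfield M -> vfield M -> vfield M) (f : S -> M) : Prop :=
  forall (q : S) (v w : 'rV[R]_n),
    range (dmap f q) (curv nabla (f q) (dmap f q v) (dmap f q w) (dmap f q v)).

(* A submanifold with its induced metric is given by its inclusion, an
   injective isometric immersion. *)
Definition submanifold_inclusion (R : realType) (r m : nat)
    (S : riemannian R r) (M : riemannian R m) (f : S -> M) : Prop :=
  isometric_immersion f /\ injective f.

Definition axiom_special (R : realType) (m : nat) (M : riemannian R m)
    (nabla : vfield M -> vfield M -> vfield M) (r : nat) : Prop :=
  forall (p : M) (W : {vspace 'rV[R]_m}), \dim W = r ->
  exists (S : riemannian R r) (f : S -> M) (q : S),
    [/\ submanifold_inclusion f, special nabla f, f q = p &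
        range (dmap f q) = [set z | z \in W]].

Definition axiom_very_special (R : realType) (m : nat) (M : riemannian R m)
    (nabla : vfield M -> vfield M -> vfield M) (r : nat) : Prop :=
  forall (p : M) (W : {vspace 'rV[R]_m}), \dim W = r ->
  exists (S : riemannian R r) (f : S -> M) (q : S),
    [/\ submanifold_inclusion f, very_special nabla f, f q = p &
        range (dmap f q) = [set z | z \in W]].

(* Main.v *)
Require Import Defs.
From mathcomp Require Import all_boot all_order all_algebra.
From mathcomp Require Import all_classical all_reals all_analysis.
From mathcomp Require Import ring lra.

(** Forward direction, at one point.  Let [e] be an orthonormal basis of the
    tangent space.  A special submanifold tangent to the span of the [e i],
    [i] in [A], forces the sum over [i] in [A] of [<R(e_i, e_j) e_i, e_k>] to
    vanish for [j] in [A] and [k] outside.  When [#|A| <= m - 2], an index of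
    [A] other than [j] can be traded for one outside [A] other than [k];
    comparing the sums shows that all their terms with index other than [j]
    agree, so each term vanishes ([exchange_sums]).  A very special
    hypersurface gives the vanishing of the single terms directly, and a
    special hypersurface gives [Ric(e_j, e_k) = 0].  All this holds in every
    orthonormal basis, and rotating the basis in the plane of [e_j] and [e_k]
    converts vanishing off-diagonal entries into equal diagonal entries
    ([rotate_diag]).  Hence
    [Ric] is a multiple [lam p] of the metric at each point [p]
    ([einstein_of_offdiag]), and in the first two cases all sectional
    curvatures at [p] equal [lam p / (m - 1)] ([sectional_of_triples]).

    From points to the manifold.  What remains is the lemma of Schur: on a
    connected manifold of dimension at least 3 the function [lam] is constant
    ([schur]).  Contracting the second Bianchi identity twice gives
    [(m - 2) d lam = 0] ([schur_frame]).  The identity itself is the Jacobi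
    identity for commutators of the operators [nabla E_i], where the [E_i] are
    the commuting coordinate fields of one chart ([second_bianchi]).  The
    covariant derivative of the curvature is taken at the centre of that
    chart, as the directional derivative of a component function corrected by
    Christoffel terms ([dcurv]).  The frame of coordinate fields is chosen
    orthonormal at the centre only, so nearby traces involve the Gram matrix;
    using its adjugate instead of its inverse keeps everything polynomial in
    the components ([einstein_frame], [dcurv_trace]).

    The curvature at a point [q] is defined through the chart centred at [q],
    whereas differentiating it requires fields living in a single chart.  The
    bridge is tensoriality ([curvature_vfield_curv]): it is proved in the first
    two arguments from the Leibniz rules, and in the third from the
    skew-symmetry of the curvature with respect to the metric.  On the
    analytic side this needs the closure of smooth maps under composition
    ([smooth_on_comp]) and the symmetry of second derivatives
    ([derive_symmetric]).

    Converse.  Constant sectional curvature determines [R(v, w) w] by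
    polarization ([curvature_of_sectional]), and [R(v, w) v] then lies in the
    plane of [v] and [w].  For a hypersurface with unit normal [N], the trace
    over the tangent space differs from the Ricci trace by [R(N, w) N], which
    is orthogonal to [N]; so in an Einstein manifold it is tangent
    ([einstein_hypersurface_special]). *)

Set Implicit Arguments.
Unset Strict Implicit.
Unset Printing Implicit Defensive.
Import Order.TTheory GRing.Theory Num.Theory.
Import numFieldNormedType.Exports.

Local Open Scope classical_set_scope.
Local Open Scope ring_scope.

Local Opaque derive diff.

(** * Smooth maps on open sets *)

(** The differential of a map that is not differentiable is an arbitrary linear
    map, so equality of germs transfers it only from a differentiable map. *)
Lemma diff_near_eq (R : realType) (V W : normedModType R) (f g : V -> W) x :
  (\forall y \near x, f y = g y) -> differentiable f x ->
  differentiable g x /\ forall v, 'd g x v = 'd f x v.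
Proof.
move=> fg df.
have fgx : f x = g x by exact: (nbhs_singleton fg).
have E : g \o shift x = cst (g x) + 'd f x +o_ 0 id.
  apply/eqaddoP => e e0.
  have /eqaddoP/(_ _ e0) H := diff_locally df.
  have fg' : \forall h \near (0 : V), f (h + x) = g (h + x).
    rewrite (near_shift x 0) /=; near=> y.
    by rewrite /shift /= sub0r subrK; near: y.
  near=> h.
  have -> : (g \o shift x - (cst (g x) + 'd f x)) h
          = (f \o shift x - (cst (f x) + 'd f x)) h.
    by rewrite !fctE /= fgx; congr (_ - _); apply/esym; near: h.
  by near: h.
have U := diff_unique (diff_continuous df) E.
split=> [|v]; last by rewrite [LHS](congr1 (fun F => F v) U).
apply/diff_locallyP; rewrite U; split=> //; exact: diff_continuous df.
Unshelve. all: by end_near. Qed.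

Lemma diff_compE (R : realType) (U V W : normedModType R) (f : U -> V)
    (g : V -> W) x (v : U) : differentiable f x -> differentiable g (f x) ->
  'd (g \o f) x v = 'd g (f x) ('d f x v).
Proof. by move=> df dg; rewrite [LHS](congr1 (fun F => F v) (diff_comp df dg)). Qed.

Lemma open_near_eq (T : topologicalType) (U : Type) (A : set T) (f g : T -> U) x :
  open A -> A x -> (forall y, A y -> f y = g y) -> \forall y \near x, f y = g y.
Proof. by move=> oA Ax fg; near=> y; apply: fg; near: y; exact: open_nbhs_nbhs.
Unshelve. all: by end_near. Qed.

Lemma iter_deriv_eq (R : realType) (V W : normedModType R) (A : set V)
    (f g : V -> W) :
  open A -> (forall x, A x -> f x = g x) ->
  forall vs x, A x -> iter_deriv vs f x = iter_deriv vs g x.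
Proof.
move=> oA fg; elim=> [|v vs IH] x Ax /=; first exact: fg.
by apply: near_eq_derive; exact: (open_near_eq oA Ax).
Qed.

Lemma smooth_on_eq (R : realType) (V W : normedModType R) (A : set V)
    (f g : V -> W) :
  open A -> (forall x, A x -> f x = g x) -> smooth_on A f -> smooth_on A g.
Proof.
move=> oA fg sf vs x Ax.
apply: (proj1 (diff_near_eq (f := iter_deriv vs f) _ (sf vs x Ax))).
apply: (open_near_eq oA Ax) => y Ay; exact: (iter_deriv_eq oA fg).
Qed.

Lemma smooth_on_sub (R : realType) (V W : normedModType R) (A B : set V)
    (f : V -> W) : A `<=` B -> smooth_on B f -> smooth_on A f.
Proof. by move=> AB sf vs x /AB Bx; exact: sf. Qed.

Lemma smooth_on_diff (R : realType) (V W : normedModType R) (A : set V)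
    (f : V -> W) x : smooth_on A f -> A x -> differentiable f x.
Proof. by move=> sf; exact: (sf [::]). Qed.

Lemma smooth_on_derive (R : realType) (V W : normedModType R) (A : set V)
    (f : V -> W) v : smooth_on A f -> smooth_on A ('D_v f).
Proof.
move=> sf vs x Ax; have := sf (rcons vs v) x Ax.
by rewrite /iter_deriv foldr_rcons.
Qed.

(** Coinduction principle: a class of differentiable maps that is stable under
    directional derivatives, up to equality on [A], consists of smooth maps.
    It replaces inductions on the order of differentiation. *)
Lemma smooth_coind (R : realType) (V W : normedModType R) (A : set V)
    (P : (V -> W) -> Prop) : open A ->
  (forall f x, P f -> A x -> differentiable f x) ->
  (forall f v, P f -> exists2 g, P g & forall x, A x -> 'D_v f x = g x) ->
  forall f, P f -> smooth_on A f.
Proof.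
move=> oA dP DP f + vs; elim/last_ind: vs f => [|vs v IH] f Pf x Ax.
  exact: dP.
have [g Pg fg] := DP f v Pf.
rewrite /iter_deriv foldr_rcons -/(iter_deriv _ _).
apply: (proj1 (diff_near_eq (f := iter_deriv vs g) _ (IH _ Pg x Ax))).
by apply: (open_near_eq oA Ax) => y Ay; apply: (iter_deriv_eq oA) => // z /fg.
Qed.

Section coordinates.
Context {R : realType} {V : normedModType R}.

(** A vector-valued map is the finite sum of its coordinates times basis
    vectors. *)
Lemma differentiable_rV n (f : V -> 'rV[R]_n) x :
  (forall j, differentiable (fun y => f y 0 j) x) -> differentiable f x.
Proof.
move=> df.
have -> : f = \sum_(j < n) (fun y => f y 0 j *: delta_mx 0 j).
  apply/funext => y; rewrite fct_sumE; exact: row_sum_delta.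
by apply: differentiable_sum => j; exact: differentiableZl.
Qed.

Lemma differentiable_rV_coord n (f : V -> 'rV[R]_n) x j :
  differentiable f x -> differentiable (fun y => f y 0 j) x.
Proof.
by move=> df; exact: (differentiable_comp df (differentiable_coord (f x) 0 j)).
Qed.

Lemma derive_coord n (f : V -> 'rV[R]_n) x v j : differentiable f x ->
  'D_v f x 0 j = 'D_v (fun y => f y 0 j) x.
Proof.
move=> df; have dv : derivable f x v by exact: diff_derivable.
by rewrite (derive_mx dv) mxE.
Qed.

Lemma smooth_on_coord n (A : set V) (f : V -> 'rV[R]_n) : open A ->
  smooth_on A f <-> forall j, smooth_on A (fun y => f y 0 j).
Proof.
move=> oA; split=> [sf j|sf].
  apply: (smooth_coind oA
    (P := fun h => exists2 g : V -> 'rV[R]_n, smooth_on A g & h = fun y => g y 0 j)).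
  - move=> _ x [g sg ->] Ax; apply: differentiable_rV_coord.
    exact: smooth_on_diff sg Ax.
  - move=> _ v [g sg ->]; exists (fun y => 'D_v g y 0 j).
      by exists ('D_v g) => //; exact: smooth_on_derive.
    by move=> x Ax; rewrite derive_coord //; exact: smooth_on_diff sg Ax.
  - by exists f.
apply: (smooth_coind oA
    (P := fun g : V -> 'rV[R]_n => forall j, smooth_on A (fun y => g y 0 j))) => //.
- move=> g x sg Ax; apply: differentiable_rV => j; exact: smooth_on_diff (sg j) Ax.
- move=> g v sg; exists ('D_v g) => // j.
  apply: (smooth_on_eq oA _ (smooth_on_derive v (sg j))) => x Ax.
  rewrite derive_coord //; apply: differentiable_rV => i.
  exact: smooth_on_diff (sg i) Ax.
Qed.

End coordinates.

Section smooth_algebra.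
Context {R : realType} {V : normedModType R} (A : set V).

(** The functions generated by smooth functions and compositions of smooth
    maps.  The chain and product rules keep directional derivatives in this
    class, so [smooth_coind] applies to sums, products and compositions at
    once. *)
Inductive smooth_expr : (V -> R) -> Prop :=
| SmoothBase f : smooth_on A f -> smooth_expr f
| SmoothComp n (B : set 'rV[R]_n) (f : V -> 'rV[R]_n) (u : 'rV[R]_n -> R) :
    smooth_on A f -> (forall x, A x -> B (f x)) -> smooth_on B u ->
    smooth_expr (u \o f)
| SmoothAdd f g : smooth_expr f -> smooth_expr g ->
    smooth_expr (fun x => f x + g x)
| SmoothMul f g : smooth_expr f -> smooth_expr g ->
    smooth_expr (fun x => f x * g x).

Lemma smooth_on_cst (W : normedModType R) (c : W) : open A ->
  smooth_on A (cst c).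
Proof.
move=> oA; apply: (smooth_coind oA (P := fun f => exists c, f = cst c)).
- by move=> _ x [d ->] _; exact: differentiable_cst.
- move=> _ v [d ->]; exists (cst 0); first by exists 0.
  by move=> x _; rewrite derive_cst.
- by exists c.
Qed.

Lemma smooth_expr_diff f x : smooth_expr f -> A x -> differentiable f x.
Proof.
move=> + Ax; elim=> {f} [f sf|n B f u sf fB su|f g _ IHf _ IHg|f g _ IHf _ IHg].
- exact: smooth_on_diff sf Ax.
- apply: differentiable_comp; first exact: smooth_on_diff sf Ax.
  exact: smooth_on_diff su (fB _ Ax).
- exact: differentiableD.
- exact: differentiableM.
Qed.

Lemma smooth_expr_sum n (F : 'I_n -> V -> R) : open A ->
  (forall i, smooth_expr (F i)) -> smooth_expr (fun x => \sum_(i < n) F i x).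
Proof.
move=> oA; elim: n F => [|n IH] F HF.
  rewrite (_ : (fun _ => _) = cst 0); last by apply/funext => x; rewrite big_ord0.
  by apply: SmoothBase; exact: smooth_on_cst.
rewrite (_ : (fun _ => _) =
  fun x => F ord0 x + \sum_(i < n) F (lift ord0 i) x).
  by apply: SmoothAdd => //; apply: IH.
by apply/funext => x; rewrite big_ord_recl.
Qed.

Lemma smooth_expr_derive f v : open A -> smooth_expr f ->
  exists2 g, smooth_expr g & forall x, A x -> 'D_v f x = g x.
Proof.
move=> oA.
elim=> {f} [f sf|n B f u sf fB su|f g ef [f' ef' ff'] eg [g' eg' gg']|
  f g ef [f' ef' ff'] eg [g' eg' gg']].
- by exists ('D_v f) => //; apply: SmoothBase; exact: smooth_on_derive.
- exists (fun x => \sum_(j < n)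
     ('D_(delta_mx 0 j) u \o f) x * 'D_v (fun y => f y 0 j) x).
    apply: smooth_expr_sum => // j; apply: SmoothMul.
      by apply: (SmoothComp sf fB); exact: smooth_on_derive.
    apply: SmoothBase; apply: smooth_on_derive.
    by move/smooth_on_coord: sf => /(_ oA).
  move=> x Ax.
  have df := smooth_on_diff sf Ax; have du := smooth_on_diff su (fB _ Ax).
  rewrite deriveE; last exact: differentiable_comp.
  rewrite diff_comp //= [X in 'd u _ X]row_sum_delta linear_sum /=.
  apply: eq_bigr => j _; rewrite linearZ /= mulrC.
  by rewrite -(derive_coord v j df) (deriveE v df) (deriveE _ du).
- exists (fun x => f' x + g' x); first exact: SmoothAdd.
  move=> x Ax; rewrite -ff' // -gg' //.
  by apply: deriveD; apply: diff_derivable; exact: smooth_expr_diff.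
- exists (fun x => f x * g' x + g x * f' x).
    by apply: SmoothAdd; apply: SmoothMul.
  move=> x Ax; rewrite -ff' // -gg' //.
  by apply: deriveM; apply: diff_derivable; exact: smooth_expr_diff.
Qed.

Lemma smooth_exprP f : open A -> smooth_expr f -> smooth_on A f.
Proof.
move=> oA; apply: (smooth_coind oA).
  by move=> g x; exact: smooth_expr_diff.
by move=> g v; exact: smooth_expr_derive.
Qed.

Hypothesis oA : open A.

Lemma smooth_onD (f g : V -> R) : smooth_on A f -> smooth_on A g ->
  smooth_on A (fun x => f x + g x).
Proof. by move=> sf sg; apply/(smooth_exprP oA)/SmoothAdd; exact: SmoothBase. Qed.

Lemma smooth_onM (f g : V -> R) : smooth_on A f -> smooth_on A g ->
  smooth_on A (fun x => f x * g x).
Proof. by move=> sf sg; apply/(smooth_exprP oA)/SmoothMul; exact: SmoothBase. Qed.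

Lemma smooth_on_comp1 n (B : set 'rV[R]_n) (f : V -> 'rV[R]_n)
    (u : 'rV[R]_n -> R) : smooth_on A f -> (forall x, A x -> B (f x)) ->
  smooth_on B u -> smooth_on A (u \o f).
Proof. by move=> sf fB su; apply/(smooth_exprP oA)/(SmoothComp sf fB su). Qed.

Lemma smooth_on_comp n k (B : set 'rV[R]_n) (f : V -> 'rV[R]_n)
    (u : 'rV[R]_n -> 'rV[R]_k) : open B ->
  smooth_on A f -> (forall x, A x -> B (f x)) ->
  smooth_on B u -> smooth_on A (u \o f).
Proof.
move=> oB sf fB /(smooth_on_coord _ oB) su.
by apply/(smooth_on_coord _ oA) => j; exact: smooth_on_comp1 sf fB (su j).
Qed.

Lemma smooth_onDv n (f g : V -> 'rV[R]_n) : smooth_on A f -> smooth_on A g ->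
  smooth_on A (fun x => f x + g x).
Proof.
move=> /(smooth_on_coord _ oA) sf /(smooth_on_coord _ oA) sg.
apply/(smooth_on_coord _ oA) => j.
by under eq_fun do rewrite mxE; exact: smooth_onD.
Qed.

Lemma smooth_onZv n (h : V -> R) (f : V -> 'rV[R]_n) : smooth_on A h ->
  smooth_on A f -> smooth_on A (fun x => h x *: f x).
Proof.
move=> sh /(smooth_on_coord _ oA) sf; apply/(smooth_on_coord _ oA) => j.
by under eq_fun do rewrite mxE; exact: smooth_onM.
Qed.

End smooth_algebra.

(** * Symmetry of second derivatives and vanishing derivatives *)

Section line_derivative.
Context {R : realType} {V W : normedModType R}.

(** Restriction to a line reduces the mean value arguments below to one real
    variable. *)
Lemma is_derive_line (f : V -> W) (a v : V) (s : R) :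
  differentiable f (a + s *: v) ->
  is_derive s 1 (fun t : R => f (a + t *: v)) ('D_v f (a + s *: v)).
Proof.
move=> df.
have dl : is_diff s (fun t : R => a + t *: v) (fun t => t *: v).
  by apply: is_diff_eq; rewrite add0r.
have dc : differentiable (f \o (fun t : R => a + t *: v)) s.
  by apply: differentiable_comp; first by case: (dl).
apply: DeriveDef; first exact: diff_derivable.
have dl' : differentiable (fun t : R => a + t *: v) s by case: (dl).
by rewrite (deriveE _ dc) (diff_comp dl' df) /= diff_val scale1r deriveE.
Qed.

End line_derivative.

Section schwarz.
Context {R : realType} {V : normedModType R}.
Variables (A : set V) (f : V -> R) (x : V).
Hypotheses (oA : open A) (Ax : A x).
Hypothesis df : forall y, A y -> differentiable f y.

(** The mean value theorem in the direction [v] turns the second difference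
    into an increment of [D_v f] in the direction [w]; differentiability of
    [D_v f] at [x] then gives its leading term. *)
Lemma second_difference (v w : V) : differentiable ('D_v f) x ->
  forall e : R, 0 < e -> \forall t \near 0^'+,
    `|f (x + t *: w + t *: v) - f (x + t *: v) - f (x + t *: w) + f x
      - t ^+ 2 * 'D_w ('D_v f) x| <= e * t ^+ 2.
Proof.
move=> dF e e0; set F := 'D_v f in dF *.
(* [t * K] bounds the displacements from [x] that occur in the second
   difference, and [+ 1] keeps [K] positive when both directions vanish. *)
set K := 2 * `|v| + `|w| + 1.
have K0 : 0 < K by rewrite /K; have := normr_ge0 v; have := normr_ge0 w; lra.
have eK0 : 0 < e / K by rewrite divr_gt0.
have nA : \forall h \near (0 : V), A (x + h).
  rewrite (near_shift x 0) /=; near=> y.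
  by rewrite /shift /= sub0r subrKC; near: y; exact: open_nbhs_nbhs.
have nF : \forall h \near (0 : V),
    `|F (x + h) - F x - 'd F x h| <= e / K * `|h|.
  have /eqaddoP/(_ _ eK0) H := diff_locally dF.
  near=> h; have -> : F (x + h) - F x - 'd F x h
     = (F \o shift x - (cst (F x) + 'd F x)) h.
    by rewrite !fctE /= opprD addrA (addrC x).
  by near: h.
have /nbhs_ballP[d /= d0 Hd] : \forall h \near (0 : V),
    A (x + h) /\ `|F (x + h) - F x - 'd F x h| <= e / K * `|h|.
  exact: filterI nA nF.
have Hd' h : `|h| < d -> A (x + h) /\ `|F (x + h) - F x - 'd F x h| <= e / K * `|h|.
  by move=> hd; apply: Hd; rewrite -ball_normE /= sub0r normrN.
near=> t.
have t0 : 0 < t by near: t; exact: nbhs_right_gt.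
have tK : t * K < d.
  by rewrite -ltr_pdivlMr //; near: t; apply: nbhs_right_lt; rewrite divr_gt0.
have bnd c1 : 0 <= c1 -> c1 <= t ->
    `|c1 *: v| <= t * `|v| /\ `|t *: w + c1 *: v| <= t * (`|v| + `|w|).
  move=> c10 c1t; have N : `|c1 *: v| <= t * `|v|.
    by rewrite normrZ ger0_norm // ler_wpM2r.
  split=> //; rewrite mulrDr addrC (le_trans (ler_normD _ _)) // lerD //.
  by rewrite normrZ gtr0_norm.
have bnd2 c1 : 0 <= c1 -> c1 <= t ->
    `|c1 *: v| < d /\ `|t *: w + c1 *: v| < d.
  move=> c10 c1t; have [b1 b2] := bnd _ c10 c1t.
  have v0 := normr_ge0 v; have w0 := normr_ge0 w.
  split; [apply: le_lt_trans b1 _|apply: le_lt_trans b2 _];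
    apply: le_lt_trans tK; rewrite ler_pM2l // /K; lra.
pose phi (s : R) := f (x + t *: w + s *: v) - f (x + s *: v).
have dphi s : 0 <= s -> s <= t ->
    is_derive s 1 phi (F (x + t *: w + s *: v) - F (x + s *: v)).
  move=> s0 st; have [b1 b2] := bnd2 _ s0 st.
  apply: is_deriveB; apply: is_derive_line; apply: df.
    by rewrite -addrA; case: (Hd' _ b2).
  by case: (Hd' _ b1).
have [c cI Hc] : exists2 c, c \in `]0, t[%R & phi t - phi 0 =
    (F (x + t *: w + c *: v) - F (x + c *: v)) * (t - 0).
  apply: (MVT t0 (df := fun s => F (x + t *: w + s *: v) - F (x + s *: v))).
    by move=> s; rewrite in_itv /= => /andP[s0 st]; apply: dphi; exact: ltW.
  apply: derivable_within_continuous => s; rewrite in_itv /= => /andP[s0 st].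
  by have [] := dphi s s0 st.
move: cI; rewrite in_itv /= => /andP[c0 ct].
have [b1 b2] := bnd _ (ltW c0) (ltW ct).
have [b1' b2'] := bnd2 _ (ltW c0) (ltW ct).
have [_ e1] := Hd' _ b1'; have [_ e2] := Hd' _ b2'.
have -> : f (x + t *: w + t *: v) - f (x + t *: v) - f (x + t *: w) + f x
     = phi t - phi 0.
  by rewrite /phi !scale0r !addr0 opprB addrA addrAC.
rewrite Hc subr0 (deriveE _ dF).
set E1 := F (x + c *: v) - F x - 'd F x (c *: v) in e1.
set E2 := F (x + (t *: w + c *: v)) - F x - 'd F x (t *: w + c *: v) in e2.
have -> : (F (x + t *: w + c *: v) - F (x + c *: v)) * t - t ^+ 2 * 'd F x w
        = t * (E2 - E1).
  rewrite /E1 /E2 -addrA linearD (linearZ _ w) /= -[t *: ('d _ _ _)]/(t * _).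
  ring.
rewrite normrM gtr0_norm // expr2 mulrCA ler_pM2l //.
apply: le_trans (ler_normB _ _) _.
apply: (le_trans (lerD e2 e1)).
rewrite -mulrDr.
apply: (@le_trans _ _ (e / K * (t * K))); last first.
  by rewrite mulrCA -mulrA mulVf ?mulr1 ?lt0r_neq0 // mulrC.
rewrite ler_pM2l //; apply: (le_trans (lerD b2 b1)).
rewrite -mulrDr ler_pM2l // /K; lra.
Unshelve. all: by end_near. Qed.

(** The second difference is symmetric in [v] and [w], and so is the
    coefficient of [t ^+ 2] in its expansion. *)
Lemma derive_symmetric (v w : V) :
  differentiable ('D_v f) x -> differentiable ('D_w f) x ->
  'D_w ('D_v f) x = 'D_v ('D_w f) x.
Proof.
move=> dv dw; apply/eqP; rewrite -subr_eq0 -normr_le0.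
apply/ler_addgt0Pl => e e0; rewrite addr0.
have e20 : 0 < e / 2 by rewrite divr_gt0.
have n1 := @second_difference v w dv _ e20.
have n2 := @second_difference w v dw _ e20.
have [t /= [[t0 H1] H2]] := filter_ex (filterI (filterI (nbhs_right_gt (0 : R)) n1) n2).
  have t20 : 0 < t ^+ 2 by rewrite exprn_gt0.
  rewrite -(ler_pM2r t20) -[X in _ * X](gtr0_norm t20) -normrM.
  move: H1 H2; rewrite (addrAC x (t *: v)).
  set D1 := 'D_w _ x; set D2 := 'D_v _ x; set T := t ^+ 2.
  clearbody D1 D2 T; set a := f _; set b := f (x + _); set c := f (x + _); set d := f x.
  move=> H1 H2.
  have -> : (D1 - D2) * T = (a - c - b + d - T * D2) - (a - b - c + d - T * D1).
    by ring.
  apply: le_trans (ler_normB _ _) _; apply: le_trans (lerD H2 H1) _.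
  by rewrite -mulrDl -splitr.
Qed.

End schwarz.

Lemma smooth_on_derive_symmetric (R : realType) (V : normedModType R) n
    (A : set V) (f : V -> 'rV[R]_n) (x v w : V) : open A -> A x ->
  smooth_on A f -> 'D_w ('D_v f) x = 'D_v ('D_w f) x.
Proof.
move=> oA Ax sf; apply/rowP => j.
have sj : smooth_on A (fun y => f y 0 j) by move/smooth_on_coord: sf => /(_ oA).
have E u y : A y -> 'D_u f y 0 j = 'D_u (fun y => f y 0 j) y.
  by move=> Ay; rewrite derive_coord //; exact: smooth_on_diff sf Ay.
have dD u : differentiable ('D_u f) x.
  exact: smooth_on_diff (smooth_on_derive u sf) Ax.
have C u1 u2 : 'D_u1 ('D_u2 f) x 0 j = 'D_u1 ('D_u2 (fun y => f y 0 j)) x.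
  rewrite (derive_coord u1 j (dD u2)).
  by apply: near_eq_derive; apply: (open_near_eq oA Ax); exact: E.
apply: (etrans (C _ _)); apply: (etrans _ (esym (C _ _))).
apply: (derive_symmetric oA Ax) => [y||].
- exact: smooth_on_diff.
- exact: smooth_on_diff (smooth_on_derive v sj) Ax.
- exact: smooth_on_diff (smooth_on_derive w sj) Ax.
Qed.

(** Mean value theorem along the segment from the centre of the ball. *)
Lemma derive0_cst (R : realType) (V : normedModType R) (f : V -> R)
    (a : V) (r : R) :
  (forall y, ball a r y -> differentiable f y) ->
  (forall y v, ball a r y -> 'D_v f y = 0) ->
  forall y, ball a r y -> f y = f a.
Proof.
move=> df f0 y ay.
have seg (s : R) : 0 <= s -> s <= 1 -> ball a r (a + s *: (y - a)).
  move=> s0 s1; move: ay; rewrite -ball_normE /= !(distrC a) addrAC subrr add0r.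
  by apply: le_lt_trans; rewrite normrZ ger0_norm // ler_piMl.
have D (s : R) : 0 <= s -> s <= 1 ->
    is_derive s 1 (fun t : R => f (a + t *: (y - a))) 0.
  move=> s0 s1; rewrite -(f0 _ (y - a) (seg s s0 s1)); apply: is_derive_line.
  exact: df (seg s s0 s1).
pose g (t : R) := f (a + t *: (y - a)).
have gc : {within `[0, 1], continuous g}.
  apply: derivable_within_continuous => s; rewrite in_itv /= => /andP[s0 s1].
  by have [] := D s s0 s1.
have gd (s : R) : s \in `]0, 1[%R -> is_derive s 1 g 0.
  by rewrite in_itv /= => /andP[s0 s1]; apply: D; exact: ltW.
have [c _] := MVT_segment ler01 gd gc.
by rewrite /g scale1r subrKC scale0r addr0 mul0r => /eqP; rewrite subr_eq0 => /eqP.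
Qed.

(** * Orthonormal bases and bilinear forms *)

Definition linear_form (R : realType) (V : lmodType R) (f : V -> R) : Prop :=
  forall (c : R) u v, f (c *: u + v) = c * f u + f v.

Section linear_forms.
Context {R : realType} {V : lmodType R} (f : V -> R).
Hypothesis fL : linear_form f.

Lemma linear_form0 : f 0 = 0.
Proof. by have := fL (-1) 0 0; rewrite scaler0 addr0 mulN1r addNr. Qed.

Lemma linear_formD u v : f (u + v) = f u + f v.
Proof. by rewrite -[u]scale1r fL mul1r scale1r. Qed.

Lemma linear_formZ c u : f (c *: u) = c * f u.
Proof. by rewrite -[c *: u]addr0 fL linear_form0 addr0. Qed.

Lemma linear_formB u v : f (u - v) = f u - f v.
Proof. by rewrite addrC -scaleN1r fL mulN1r addrC. Qed.

Lemma linear_form_sum (I : finType) (F : I -> V) :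
  f (\sum_i F i) = \sum_i f (F i).
Proof. exact: (big_morph f linear_formD linear_form0). Qed.

Lemma linear_form_comb (I : finType) (c : I -> R) (F : I -> V) :
  f (\sum_i c i *: F i) = \sum_i c i * f (F i).
Proof. by rewrite linear_form_sum; apply: eq_bigr => i _; exact: linear_formZ. Qed.

End linear_forms.

Lemma sum_delta_l (R : realType) n (j : 'I_n) (F : 'I_n -> R) :
  \sum_i (i == j)%:R * F i = F j.
Proof.
rewrite (bigD1 j) //= eqxx mul1r big1 ?addr0 // => i /negbTE ->.
by rewrite mul0r.
Qed.

Lemma sum_delta_r (R : realType) n (j : 'I_n) (F : 'I_n -> R) :
  \sum_i (j == i)%:R * F i = F j.
Proof. by rewrite -[RHS]sum_delta_l; apply: eq_bigr => i _; rewrite eq_sym. Qed.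

Section euclidean.
Context {R : realType} {m : nat}.
Local Notation V := 'rV[R]_m.
Variable g : V -> V -> R.
Hypothesis g_linear : forall v, linear_form (g ^~ v).
Hypothesis g_sym : forall u v, g u v = g v u.
Hypothesis g_pos : forall v, v != 0 -> 0 < g v v.

Lemma g_linear_r v : linear_form (g v).
Proof. by move=> c u w; rewrite g_sym g_linear !(g_sym v). Qed.

Lemma normalize (v : V) : v != 0 ->
  exists2 a : R, a != 0 & exists2 e : V, g e e = 1 & v = a *: e.
Proof.
move=> v0; have gv := g_pos v0.
have s0 : Num.sqrt (g v v) != 0 by rewrite gt_eqF // sqrtr_gt0.
have ss : Num.sqrt (g v v) ^+ 2 = g v v by rewrite sqr_sqrtr // ltW.
exists (Num.sqrt (g v v)) => //; exists ((Num.sqrt (g v v))^-1 *: v).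
  rewrite (linear_formZ (@g_linear _)) (linear_formZ (@g_linear_r _)).
  set s := Num.sqrt _ in s0 ss *; rewrite -ss; field; exact: s0.
by rewrite scalerA mulfV // scale1r.
Qed.

Definition orthonormal_family (I : eqType) (e : I -> V) : Prop :=
  forall i j, g (e i) (e j) = (i == j)%:R.

(** The linear forms [g _ (e i)] are fewer than [m], so they have a common
    nonzero zero. *)
Lemma exists_unit_normal k (e : 'I_k -> V) : (k < m)%N ->
  exists2 u : V, g u u = 1 & forall i, g u (e i) = 0.
Proof.
move=> km; pose B : 'M[R]_(m, k) := \matrix_(a, i) g (delta_mx 0 a) (e i).
have BE v i : (v *m B) 0 i = g v (e i).
  rewrite mxE [in RHS](row_sum_delta v).
  rewrite (linear_form_comb (@g_linear (e i))).
  by apply: eq_bigr => a _; rewrite mxE.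
have : kermx B != 0.
  rewrite kermx_eq0 /row_free; apply/negP => /eqP rB.
  by have := rank_leq_col B; rewrite rB leqNgt km.
case/rowV0Pn => v /sub_kermxP vB v0.
have [a a0 [u uu va]] := normalize v0; exists u => // i.
apply: (mulfI a0); rewrite mulr0 -(linear_formZ (@g_linear _)) -va -BE vB mxE.
reflexivity.
Qed.

(** The given family is indexed by [nat], with only its first [k] values
    relevant, so that extending it does not change the index type. *)
Lemma orthonormal_extension k (e : nat -> V) : (k <= m)%N ->
  (forall i j, (i < k)%N -> (j < k)%N -> g (e i) (e j) = (i == j)%:R) ->
  exists2 f : 'I_m -> V, orthonormal_family f &
    forall i : 'I_m, (i < k)%N -> f i = e i.
Proof.
move=> km; move Ed: (m - k)%N => d.
elim: d k km e Ed => [|d IH] k km e Ed oe.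
  exists (fun i : 'I_m => e i) => // i j.
  by rewrite oe //; apply: leq_trans (ltn_ord _) _; rewrite -subn_eq0 Ed.
have km' : (k < m)%N by rewrite -subn_gt0 Ed.
have [u u1 ue] := exists_unit_normal (fun i : 'I_k => e i) km'.
pose e' i := if (i < k)%N then e i else u.
have e'k i : (i < k)%N -> e' i = e i by rewrite /e' => ->.
have ue' i : (i < k)%N -> g u (e i) = 0.
  by move=> ik; have := ue (Ordinal ik).
have oe' i j : (i < k.+1)%N -> (j < k.+1)%N -> g (e' i) (e' j) = (i == j)%:R.
  rewrite !ltnS /e'; case: (ltngtP i k) => // ik _; case: (ltngtP j k) => // jk _.
  - exact: oe.
  - by rewrite g_sym ue' // jk ltn_eqF.
  - by rewrite ue' // ik gtn_eqF.
  - by rewrite ik jk eqxx.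
have [|f of_ fe] := IH k.+1 km' e' _ oe'; first by rewrite subnS Ed.
by exists f => // i ik; rewrite fe ?e'k // ltnW.
Qed.

Lemma exists_orthonormal : exists e : 'I_m -> V, orthonormal_family e.
Proof. by have [//|//|f of_ _] := @orthonormal_extension 0 (fun=> 0); exists f. Qed.

Lemma orthonormal_expansion (e : 'I_m -> V) v : orthonormal_family e ->
  v = \sum_i g v (e i) *: e i.
Proof.
move=> oe; pose A : 'M[R]_m := \matrix_i e i.
pose B : 'M[R]_m := \matrix_(a, i) g (delta_mx 0 a) (e i).
have BE u i : (u *m B) 0 i = g u (e i).
  rewrite mxE [in RHS](row_sum_delta u).
  rewrite (linear_form_comb (@g_linear (e i))).
  by apply: eq_bigr => a _; rewrite mxE.
have AB : A *m B = 1%:M.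
  apply/matrixP => i j; rewrite [RHS]mxE -oe -BE -(rowK e i) -row_mul.
  by rewrite [RHS]mxE.
rewrite -[LHS]mulmx1 -(mulmx1C AB) mulmxA.
rewrite [_ *m A](mulmx_sum_row); apply: eq_bigr => i _.
by rewrite BE rowK.
Qed.

Lemma parseval (e : 'I_m -> V) u v : orthonormal_family e ->
  \sum_i g u (e i) * g v (e i) = g u v.
Proof.
move=> oe; rewrite [in RHS](orthonormal_expansion v oe).
rewrite (linear_form_comb (@g_linear_r u)).
by apply: eq_bigr => i _; rewrite mulrC.
Qed.

(** The matrix of inner products between two orthonormal bases is orthogonal. *)
Lemma trace_independent (Q : V -> V -> R) (e f : 'I_m -> V) :
  (forall v, linear_form (Q ^~ v)) -> (forall v, linear_form (Q v)) ->
  orthonormal_family e -> orthonormal_family f ->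
  \sum_i Q (e i) (e i) = \sum_i Q (f i) (f i).
Proof.
move=> Ql Qr oe of_.
have E i : Q (e i) (e i)
  = \sum_j \sum_k (g (e i) (f j) * g (e i) (f k)) * Q (f j) (f k).
  rewrite {1}(orthonormal_expansion (e i) of_) (linear_form_comb (Ql _)).
  apply: eq_bigr => j _; rewrite {2}(orthonormal_expansion (e i) of_).
  rewrite (linear_form_comb (Qr _)) mulr_sumr.
  by apply: eq_bigr => k _; rewrite mulrA.
rewrite (eq_bigr _ (fun i _ => E i)) exchange_big; apply: eq_bigr => j _ /=.
rewrite exchange_big /= -[RHS](sum_delta_r j (fun k => Q (f j) (f k))).
apply: eq_bigr => k _; rewrite -mulr_suml; congr (_ * _).
rewrite -of_ -(parseval (f j) (f k) oe).
by apply: eq_bigr => i _; rewrite !(g_sym (e i)).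
Qed.

(** Rotation in the plane of [e j] and [e k].  [rotate_diag] only needs
    an angle with nonzero sine and cosine, and the point [(3/5, 4/5)] of the
    circle avoids square roots. *)
Definition rotate (j k : 'I_m) (e : 'I_m -> V) : 'I_m -> V := fun i =>
  if i == j then (3 / 5) *: e j + (4 / 5) *: e k
  else if i == k then (- (4 / 5)) *: e j + (3 / 5) *: e k
  else e i.

Lemma rotate_orthonormal j k (e : 'I_m -> V) : j != k ->
  orthonormal_family e -> orthonormal_family (rotate j k e).
Proof.
move=> jk oe i l; have kj : k != j by rewrite eq_sym.
have L c a b c' u : g (c *: a + c' *: b) u = c * g a u + c' * g b u.
  by rewrite g_linear (linear_formZ (@g_linear u)).
have Rr c a b c' u : g u (c *: a + c' *: b) = c * g u a + c' * g u b.
  by rewrite g_linear_r (linear_formZ (@g_linear_r u)).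
rewrite /rotate.
case: (eqVneq i j) => [ij|ij]; case: (eqVneq l j) => [lj|lj];
  try (case: (eqVneq l k) => [lk|lk]); try (case: (eqVneq i k) => [ik|ik]);
  subst; try (by rewrite eqxx in jk); rewrite ?L ?Rr ?oe ?eqxx ?(eq_sym _ l)
    ?(negbTE ij) ?(negbTE lj) ?(negbTE jk) ?(negbTE kj) ?(negbTE lk) ?(negbTE ik) //=;
  try by field.
Qed.

(** After the rotation the off-diagonal entry is a combination of the old
    off-diagonal entries, which vanish, and of a nonzero multiple of the
    difference of the diagonal entries. *)
Lemma rotate_diag (Q : V -> V -> R) (e : 'I_m -> V) j k :
  (forall v, linear_form (Q ^~ v)) -> (forall v, linear_form (Q v)) ->
  j != k -> Q (e j) (e k) = 0 -> Q (e k) (e j) = 0 ->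
  Q (rotate j k e j) (rotate j k e k) = 0 -> Q (e j) (e j) = Q (e k) (e k).
Proof.
move=> Ql Qr jk q1 q2; rewrite /rotate eqxx (eq_sym k) (negbTE jk) eqxx.
rewrite Ql (linear_formZ (Ql _)) !Qr !(linear_formZ (Qr _)) q1 q2 => H.
lra.
Qed.

End euclidean.

(** * Algebraic curvature tensors *)

(** The symmetries shared by all curvature tensors of Levi-Civita connections.
    Linearity in the other three arguments follows from them. *)
Record curvature_tensor (R : realType) (V : lmodType R)
    (F : V -> V -> V -> V -> R) : Prop := CurvatureTensor {
  ct_linear : forall w u z, linear_form (fun v => F v w u z);
  ct_anti12 : forall v w u z, F v w u z = - F w v u z;
  ct_anti34 : forall v w u z, F v w u z = - F v w z u;
  ct_bianchi : forall v w u z, F v w u z + F w u v z + F u v w z = 0 }.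

Section curvature_algebra.
Context {R : realType} {V : lmodType R} (F : V -> V -> V -> V -> R).
Hypothesis FC : curvature_tensor F.

(** Combine, with signs, the four Bianchi identities that have a different
    vector in the last slot. *)
Lemma ct_pair v w u z : F v w u z = F u z v w.
Proof.
have B1 := ct_bianchi FC v w u z; have B2 := ct_bianchi FC w u z v.
have B3 := ct_bianchi FC u z v w; have B4 := ct_bianchi FC z v w u.
have A1 := ct_anti34 FC w u z v; have A2 := ct_anti34 FC u z w v.
have A3 := ct_anti34 FC z w u v; have A3' := ct_anti12 FC z w v u.
have A4 := ct_anti34 FC z v u w; have A5 := ct_anti34 FC v u z w.
have A5' := ct_anti12 FC v u w z; have A6 := ct_anti34 FC v w z u.
lra.
Qed.

Lemma ct_linear2 v u z : linear_form (fun w => F v w u z).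
Proof.
move=> c a b; rewrite !(ct_anti12 FC v) (ct_linear FC); ring.
Qed.

Lemma ct_linear3 v w z : linear_form (fun u => F v w u z).
Proof. by move=> c a b; rewrite !(ct_pair v w) (ct_linear FC). Qed.

Lemma ct_linear4 v w u : linear_form (fun z => F v w u z).
Proof. by move=> c a b; rewrite !(ct_pair v w) ct_linear2. Qed.

Lemma ct_diag12 v u z : F v v u z = 0.
Proof. have := ct_anti12 FC v v u z; lra. Qed.

Lemma ct_diag34 v w u : F v w u u = 0.
Proof. have := ct_anti34 FC v w u u; lra. Qed.

(** By the pair symmetry [F v w w z] is symmetric in [v] and [z], hence
    determined by its diagonal. *)
Lemma ct_polarization (g : V -> V -> R) c :
  (forall v, linear_form (g ^~ v)) -> (forall u v, g u v = g v u) ->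
  (forall v w, F v w w v = c * (g v v * g w w - g v w ^+ 2)) ->
  forall v w z, F v w w z = c * (g v z * g w w - g v w * g w z).
Proof.
move=> gl gs H v w z.
have D x y t : g (x + y) t = g x t + g y t by exact: (linear_formD (gl t)).
have := H (v + z) w.
have -> : F (v + z) w w (v + z) = F v w w v + F v w w z + (F z w w v + F z w w z).
  rewrite (linear_formD (ct_linear FC w w (v + z))).
  by rewrite !(linear_formD (ct_linear4 _ w w)).
have P : F z w w v = F v w w z.
  by rewrite ct_pair (ct_anti12 FC) (ct_anti34 FC) opprK.
rewrite P !H !D !(gs _ (v + z)) !D !(gs z) !(gs w) (gs v z) => E.
lra.
Qed.

End curvature_algebra.

(** With the curvature convention in force this trace is minus the Ricci form. *)
Definition ricci_sum (R : realType) m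
    (F : 'rV[R]_m -> 'rV[R]_m -> 'rV[R]_m -> 'rV[R]_m -> R)
    (e : 'I_m -> 'rV[R]_m) (w z : 'rV[R]_m) : R :=
  \sum_i F (e i) w (e i) z.

Section pointwise_curvature.
Context {R : realType} {m : nat}.
Local Notation V := 'rV[R]_m.
Variables (g : V -> V -> R) (F : V -> V -> V -> V -> R).
Hypothesis g_linear : forall v, linear_form (g ^~ v).
Hypothesis g_sym : forall u v, g u v = g v u.
Hypothesis g_pos : forall v, v != 0 -> 0 < g v v.
Hypothesis FC : curvature_tensor F.

Local Notation orthonormal e := (@orthonormal_family R m g 'I_m e).
Let g_linear_r := g_linear_r g_linear g_sym.

Lemma ricci_sum_independent (e f : 'I_m -> V) w z :
  orthonormal e -> orthonormal f -> ricci_sum F e w z = ricci_sum F f w z.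
Proof.
apply: (trace_independent g_linear g_sym (Q := fun x y => F x w y z)) => v.
  exact: ct_linear.
exact: ct_linear3.
Qed.

Lemma ricci_sum_linear_l (e : 'I_m -> V) z : linear_form (ricci_sum F e ^~ z).
Proof.
move=> c u v; rewrite /ricci_sum mulr_sumr -big_split; apply: eq_bigr => i _.
exact: ct_linear2.
Qed.

Lemma ricci_sum_linear_r (e : 'I_m -> V) w : linear_form (ricci_sum F e w).
Proof.
move=> c u v; rewrite /ricci_sum mulr_sumr -big_split; apply: eq_bigr => i _.
exact: ct_linear4.
Qed.

(** In every orthonormal basis the trace form has vanishing off-diagonal
    entries; rotations then make its diagonal entries equal. *)
Lemma einstein_of_offdiag : (0 < m)%N ->
  (forall e j k, orthonormal e -> j != k -> ricci_sum F e (e j) (e k) = 0) ->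
  exists rho, forall e w z, orthonormal e -> ricci_sum F e w z = - (rho * g w z).
Proof.
move=> m0 H; have [e oe] := exists_orthonormal g_linear g_sym g_pos.
pose Q := ricci_sum F e.
have Ql : forall v, linear_form (Q ^~ v) by exact: ricci_sum_linear_l.
have Qr : forall v, linear_form (Q v) by exact: ricci_sum_linear_r.
pose i0 := Ordinal m0.
have D j : Q (e j) (e j) = Q (e i0) (e i0).
  have [->//|ji] := eqVneq j i0.
  apply: (rotate_diag Ql Qr ji); [exact: H|by apply: H; rewrite // eq_sym|].
  have or := rotate_orthonormal g_linear g_sym ji oe.
  by rewrite /Q (ricci_sum_independent _ _ oe or); exact: H.
exists (- Q (e i0) (e i0)) => f w z of_; rewrite (ricci_sum_independent _ _ of_ oe).
rewrite mulNr opprK -/(Q w z) -(parseval g_linear g_sym w z oe) mulr_sumr.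
rewrite {1}(orthonormal_expansion g_linear w oe) (linear_form_comb (Ql z)).
apply: eq_bigr => i _; rewrite mulrCA; congr (_ * _).
rewrite [in LHS](orthonormal_expansion g_linear z oe) (linear_form_comb (Qr _)).
rewrite (bigD1 i) //= big1 ?addr0 => [|k ki]; first by rewrite D mulrC.
by rewrite /Q H ?mulr0 // eq_sym.
Qed.

Hypothesis triples : forall e i j k, orthonormal e ->
  i != j -> i != k -> j != k -> F (e i) (e j) (e i) (e k) = 0.

Lemma offdiag_of_triples e j k : orthonormal e -> j != k ->
  ricci_sum F e (e j) (e k) = 0.
Proof.
move=> oe jk; apply: big1 => i _.
have [->|ij] := eqVneq i j; first exact: ct_diag12.
have [->|ik] := eqVneq i k; first exact: ct_diag34.
exact: triples.
Qed.

(** For fixed [j] the Jacobi operator of [e j] has vanishing off-diagonal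
    entries in every orthonormal basis containing [e j].  Hence it is a multiple
    of the identity on the complement of [e j], and its trace is the Ricci
    curvature. *)
Lemma sectional_of_triples rho e i j : (1 < m)%N ->
  (forall e w z, orthonormal e -> ricci_sum F e w z = - (rho * g w z)) ->
  orthonormal e -> i != j -> F (e i) (e j) (e j) (e i) = rho / (m.-1)%:R.
Proof.
move=> m1 H oe ij.
(* Rotating in the plane of [e k] and [e i] fixes [e j]. *)
have D k : k != j -> F (e k) (e j) (e k) (e j) = F (e i) (e j) (e i) (e j).
  move=> kj; have [->//|ki] := eqVneq k i.
  have S x y t : F (e x) (e y) (e x) (e t) = F (e y) (e x) (e t) (e x).
    by rewrite (ct_anti12 FC) (ct_anti34 FC) opprK.
  pose Q x y := F (e j) x (e j) y.
  have Ql : forall v, linear_form (Q ^~ v) by move=> v; exact: ct_linear2.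
  have Qr : forall v, linear_form (Q v) by move=> v; exact: ct_linear4.
  rewrite (S k j j) (S i j j).
  apply: (rotate_diag Ql Qr ki).
  - by apply: triples; rewrite // eq_sym.
  - by apply: triples; rewrite // eq_sym.
  have or := rotate_orthonormal g_linear g_sym ki oe.
  have ej : rotate k i e j = e j by rewrite /rotate !(eq_sym j) (negbTE kj) (negbTE ij).
  by rewrite /Q -ej; apply: triples; rewrite // eq_sym.
have := H e (e j) (e j) oe; rewrite /ricci_sum oe eqxx mulr1 (bigD1 j) //=.
rewrite (ct_diag12 FC) add0r (eq_bigr (fun=> F (e i) (e j) (e i) (e j))) //.
rewrite sumr_const (cardC1 j) card_ord => E.
have m0 : (m.-1)%:R != 0 :> R by rewrite pnatr_eq0 -lt0n -ltnS prednK // ltnW.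
rewrite (ct_anti34 FC); apply: (mulIf m0); rewrite mulfVK // mulNr mulr_natr.
by rewrite E opprK.
Qed.

End pointwise_curvature.

Section sectional.
Context {R : realType} {m : nat}.
Local Notation V := 'rV[R]_m.
Variables (g : V -> V -> R) (F : V -> V -> V -> V -> R).
Hypothesis g_linear : forall v, linear_form (g ^~ v).
Hypothesis g_sym : forall u v, g u v = g v u.
Hypothesis g_pos : forall v, v != 0 -> 0 < g v v.
Hypothesis FC : curvature_tensor F.
Local Notation orthonormal e := (@orthonormal_family R m g 'I_m e).
Let g_linear_r := g_linear_r g_linear g_sym.

(** Gram-Schmidt for two vectors, completed to a basis of the whole space. *)
Lemma free_plane (v w : V) : free [:: v; w] ->
  exists (e : 'I_m -> V) (i j : 'I_m) (a b c : R),
    [/\ orthonormal e, i != j, a * c != 0, v = a *: e i &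
        w = b *: e i + c *: e j].
Proof.
move=> fvw.
have m2 : (2 <= m)%N.
  have := dimvS (subvf <<[:: v; w]>>); rewrite (eqP (fvw : _ == _)).
  by rewrite dimvf /dim /= mul1n.
have vw : perm_eq [:: v; w] [:: w; v] by rewrite (perm_catC [:: v] [:: w]).
move: fvw; rewrite (perm_free vw) free_cons span_seq1.
rewrite seq1_free => /andP[wv v0].
have [a a0 [e0 e00 va]] := normalize g_linear g_sym g_pos v0.
pose w' := w - g w e0 *: e0.
have w'0 : w' != 0.
  apply: contra wv; rewrite subr_eq0 => /eqP ->; apply/vlineP.
  by exists (g w e0 / a); rewrite va scalerA mulfVK.
have w'e : g w' e0 = 0.
  by rewrite /w' (linear_formB (g_linear _)) (linear_formZ (g_linear _)) e00 mulr1 subrr.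
have [c c0 [e1 e11 wc]] := normalize g_linear g_sym g_pos w'0.
have e10 : g e1 e0 = 0.
  apply: (mulfI c0); rewrite mulr0 -(linear_formZ (g_linear _)) -wc.
  exact: w'e.
pose f n := if n == 0%N then e0 else e1.
have of_ i j : (i < 2)%N -> (j < 2)%N -> g (f i) (f j) = (i == j)%:R.
  by case: i => [|[|//]]; case: j => [|[|//]] _ _ //=; rewrite /f //= g_sym.
have [e oe ef] := orthonormal_extension g_linear g_sym g_pos m2 of_.
have m0 : (0 < m)%N by exact: leq_trans m2.
exists e, (Ordinal m0), (Ordinal m2), a, (g w e0), c; split=> //.
- by rewrite mulf_neq0.
- by rewrite ef.
- by rewrite !ef //= -wc addrC subrK.
Qed.

(** Both the numerator and the denominator of the sectional curvature scale by
    the squared determinant of the change of basis of the plane. *)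
Lemma plane_curvature (e : 'I_m -> V) i j a b c v w :
  orthonormal e -> i != j -> v = a *: e i -> w = b *: e i + c *: e j ->
  F v w w v = (a * c) ^+ 2 * F (e i) (e j) (e j) (e i) /\
  g v v * g w w - g v w ^+ 2 = (a * c) ^+ 2.
Proof.
move=> oe ij -> ->; split.
  rewrite (linear_formZ (ct_linear FC _ _ _)) (linear_formZ (ct_linear4 FC _ _ _)).
  rewrite (ct_linear2 FC) (linear_formZ (ct_linear2 FC _ _ _)) (ct_diag12 FC).
  rewrite (ct_linear3 FC) (linear_formZ (ct_linear3 FC _ _ _)) (ct_diag34 FC).
  ring.
have ji : (j == i) = false by rewrite eq_sym (negbTE ij).
rewrite !(linear_formZ (g_linear _)) !(linear_formZ (g_linear_r _)).
rewrite !g_linear !g_linear_r !(linear_formZ (g_linear _)) !(linear_formZ (g_linear_r _)).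
rewrite !oe !eqxx (negbTE ij) ji /=; ring.
Qed.

Lemma sectional_of_planes k :
  (forall e i j, orthonormal e -> i != j -> F (e i) (e j) (e j) (e i) = k) ->
  forall v w, free [:: v; w] ->
  F v w w v / (g v v * g w w - g v w ^+ 2) = k.
Proof.
move=> H v w /free_plane[e [i [j [a [b [c [oe ij ac ev ew]]]]]]].
have [-> ->] := plane_curvature oe ij ev ew.
by rewrite (H e) // mulrAC mulfV ?mul1r // expf_neq0.
Qed.

Lemma curvature_of_sectional k :
  (forall v w, free [:: v; w] ->
    F v w w v / (g v v * g w w - g v w ^+ 2) = k) ->
  forall v w z, F v w w z = k * (g v z * g w w - g v w * g w z).
Proof.
move=> H; apply: (ct_polarization FC g_linear g_sym) => v w.
have [fvw|] := boolP (free [:: v; w]).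
  rewrite -(H v w fvw) mulfVK //.
  have [e [i [j [a [b [c [oe ij ac ev ew]]]]]]] := free_plane fvw.
  by have [_ ->] := plane_curvature oe ij ev ew; rewrite expf_neq0.
rewrite free_cons seq1_free span_seq1 negb_and !negbK => /orP[/vlineP[c ->]|/eqP->].
  rewrite (linear_formZ (ct_linear FC _ _ _)) (ct_diag12 FC).
  rewrite !(linear_formZ (g_linear _)) !(linear_formZ (g_linear_r _)); ring.
rewrite (linear_form0 (ct_linear2 FC _ _ _)) !(linear_form0 (g_linear_r _)); ring.
Qed.

End sectional.

(** * Exchanging summation indices *)

Lemma exists_subset_card (T : finType) (B : {set T}) n : (n <= #|B|)%N ->
  exists2 A : {set T}, A \subset B & #|A| = n.
Proof.
move=> /card_geqP[s [us ss sB]]; exists [set x in s].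
  by apply/fintype.subsetP => x; rewrite inE => /sB.
by rewrite cardsE; apply/eqP; rewrite -ss; apply/eqP/card_uniqP.
Qed.

(** All terms with index other than [j] and [k] are equal: replacing one index
    of [A] by another leaves the vanishing sum unchanged, and [r <= m - 2]
    leaves room for the replacement.  The sum is then [r - 1] times their common
    value. *)
Lemma exchange_sums (R : realType) m r (x : 'I_m -> R) (j k : 'I_m) :
  (2 <= r)%N -> (r <= m - 2)%N -> j != k -> x j = 0 ->
  (forall A : {set 'I_m}, #|A| = r -> j \in A -> k \notin A ->
    \sum_(i in A) x i = 0) ->
  forall i, i != k -> x i = 0.
Proof.
move=> r2 rm jk xj H.
have S i (T : {set 'I_m}) : i != j -> i != k -> j \notin T -> k \notin T ->
    i \notin T -> #|T| = (r - 2)%N -> x i = - \sum_(t in T) x t.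
  move=> ij ik jT kT iT cT.
  have jiT : j \notin i |: T by rewrite !inE negb_or eq_sym ij.
  have := H (j |: (i |: T)).
  rewrite cardsU1 jiT cardsU1 iT cT => /(_ _ _ _)/[!big_setU1] //=.
  rewrite xj add0r => E; apply/eqP; rewrite -addr_eq0; apply/eqP; apply: E.
  - by rewrite !addnA subnKC.
  - by rewrite !inE eqxx.
  - by rewrite !inE !negb_or !(eq_sym k) jk ik.
have C (B : {set 'I_m}) n : (#|B| <= n)%N -> (m - n <= #|~: B|)%N.
  by move=> Bn; rewrite cardsCs finset.setCK card_ord leq_sub2l.
have X i i' : i != j -> i != k -> i' != j -> i' != k -> x i = x i'.
  move=> ij ik ij' ik'.
  have [|T TB cT] := @exists_subset_card _ (~: [set j; k; i; i']) (r - 2)%N.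
    apply: leq_trans (C _ 4%N _).
      by rewrite (_ : 4 = 2 + 2)%N // subnDA leq_sub2r.
    apply: leq_trans (leq_card_setU _ _) _; rewrite cards1 addn1 ltnS.
    apply: leq_trans (leq_card_setU _ _) _; rewrite cards1 addn1 ltnS.
    by rewrite cards2; case: (_ != _).
  have N t : t \in [set j; k; i; i']%SET -> t \notin T.
    by move=> tB; apply/negP => /(fintype.subsetP TB); rewrite inE tB.
  by rewrite (S i T) ?(S i' T) // ?N // !inE eqxx ?orbT.
move=> i ik; have [->//|ij] := eqVneq i j.
have [|T TB cT] := @exists_subset_card _ (~: [set j; k; i]) (r - 2)%N.
  apply: leq_trans (C _ 3%N _).
    apply: leq_trans (leq_sub2r 2 rm) _; rewrite -subnDA leq_sub2l //.
  apply: leq_trans (leq_card_setU _ _) _; rewrite cards1 addn1 ltnS.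
  by rewrite cards2; case: (_ != _).
have N t : t \in [set j; k; i]%SET -> t \notin T.
  by move=> tB; apply/negP => /(fintype.subsetP TB); rewrite inE tB.
have := S i T ij ik; rewrite !N ?inE ?eqxx ?orbT // => /(_ isT isT isT cT) E.
have E2 : \sum_(t in T) x t = (r - 2)%:R * x i.
  rewrite -cT mulrC mulr_natr -sumr_const; apply: eq_bigr => t tT.
  by apply: X => //; apply/negP => /eqP te; have := N t;
    rewrite !inE te eqxx ?orbT -te tT => /(_ isT).
move: E; rewrite E2 => /eqP; rewrite -addr_eq0 -{1}[x i]mul1r -mulrDl (addrC 1).
rewrite mulf_eq0 => /orP[|/eqP//]; rewrite natr1 pnatr_eq0 //.
Qed.

(** * Charts, vector fields and directional derivatives *)

Section charts.
Context {R : realType} {m : nat} {M : manifold R m}.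
Implicit Types (a b c p q : M) (U : set M) (X Y : vfield M) (h : M -> R).

(** Charts are homeomorphisms onto open sets, so images of neighbourhoods are
    neighbourhoods. *)
Lemma chart_image_near a q U : chart_dom a q -> open U -> U q ->
  nbhs (chart a q) (chart a @` (chart_dom a `&` U)).
Proof.
move=> aq oU Uq.
have n1 : nbhs (chart a q) (chart a @` chart_dom a).
  by apply: open_nbhs_nbhs; split; [exact: chart_image_open|exists q].
have n2 : nbhs (chart a q) (chart_inv a @^-1` U).
  apply: (chart_inv_continuous aq).
  by apply: open_nbhs_nbhs; split; rewrite ?chartK.
apply: filterS (filterI n1 n2) => _ [[q' aq' <-]] /=; rewrite chartK // => Uq'.
by exists q'.
Qed.

Lemma chart_image_setI_open a U : open U ->
  open (chart a @` (chart_dom a `&` U)).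
Proof.
move=> oU; rewrite openE => _ [q [aq Uq] <-]; exact: chart_image_near.
Qed.

Definition transition a b : 'rV[R]_m -> 'rV[R]_m := chart b \o chart_inv a.

Lemma transitionE a b q : chart_dom a q -> transition a b (chart a q) = chart b q.
Proof. by move=> aq; rewrite /transition /= chartK. Qed.

Lemma transition_diff a b q : chart_dom a q -> chart_dom b q ->
  differentiable (transition a b) (chart a q).
Proof.
move=> aq bq.
have xA : (chart a @` (chart_dom a `&` chart_dom b)) (chart a q) by exists q.
exact: smooth_on_diff (@chart_compat _ _ M a b) xA.
Qed.

Lemma transition_comp_near (T : Type) a b q (h : M -> T) :
  chart_dom a q -> chart_dom b q ->
  \forall x \near chart a q,
    (h \o chart_inv b \o transition a b) x = (h \o chart_inv a) x.
Proof.
move=> aq bq.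
apply: filterS (chart_image_near aq (chart_dom_open b) bq) => _ [q' [aq' bq'] <-].
by rewrite /transition /= !chartK.
Qed.

(** Chain rule for a change of chart; the other statements about changing
    charts, such as [chart_change_comp], are instances of it. *)
Lemma diff_chart_swap (W : normedModType R) a b q (h : M -> W) (v : 'rV[R]_m) :
  chart_dom a q -> chart_dom b q -> differentiable (h \o chart_inv b) (chart b q) ->
  differentiable (h \o chart_inv a) (chart a q) /\
  'd (h \o chart_inv a) (chart a q) v
  = 'd (h \o chart_inv b) (chart b q) (chart_change a b q v).
Proof.
move=> aq bq dh.
have dT := transition_diff aq bq.
have dh' : differentiable (h \o chart_inv b) (transition a b (chart a q)).
  by rewrite transitionE.
have [d1 e1] := diff_near_eq (transition_comp_near h aq bq)
  (differentiable_comp dT dh').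
split; first exact: d1.
rewrite [LHS]e1 [LHS](diff_compE v dT dh').
rewrite (transitionE _ aq) /chart_change; reflexivity.
Qed.

Lemma chart_change_comp a b c q (v : 'rV[R]_m) :
  chart_dom a q -> chart_dom b q -> chart_dom c q ->
  chart_change b c q (chart_change a b q v) = chart_change a c q v.
Proof.
move=> aq bq cq.
by have [_ E] := diff_chart_swap v aq bq (transition_diff bq cq); rewrite [RHS]E.
Qed.

Lemma chart_change_id a q (v : 'rV[R]_m) :
  chart_dom a q -> chart_change a a q v = v.
Proof.
move=> aq; rewrite /chart_change.
have n : \forall x \near chart a q, id x = (chart a \o chart_inv a) x.
  apply: filterS (chart_image_near aq openT I) => _ [q' [aq' _] <-] /=.
  by rewrite chartK.
have di : is_diff (chart a q) (id : 'rV[R]_m -> 'rV[R]_m) id by exact: is_diff_id.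
have d0 : differentiable (id : 'rV[R]_m -> 'rV[R]_m) (chart a q) by case: (di).
by have [_ E] := diff_near_eq n d0; rewrite [LHS]E diff_val.
Qed.

Lemma chart_changeK a b q (v : 'rV[R]_m) : chart_dom a q -> chart_dom b q ->
  chart_change b a q (chart_change a b q v) = v.
Proof. by move=> aq bq; rewrite chart_change_comp // chart_change_id. Qed.

Lemma coord_vfield_center a (v : 'rV[R]_m) : coord_vfield a v a = v.
Proof. by rewrite /coord_vfield chart_change_id //; exact: chart_dom_center. Qed.

Lemma vfield_coordE a X q : chart_dom a q ->
  vfield_coord a X (chart a q) = chart_change q a q (X q).
Proof. by move=> aq; rewrite /vfield_coord chartK. Qed.

Lemma vfield_coord_coord a b q (v : 'rV[R]_m) : chart_dom a q -> chart_dom b q ->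
  vfield_coord b (coord_vfield a v) (chart b q)
  = 'D_v (transition a b) (chart a q).
Proof.
move=> aq bq; rewrite vfield_coordE // /coord_vfield.
rewrite chart_change_comp //; last exact: chart_dom_center.
by rewrite deriveE //; exact: transition_diff.
Qed.

(** In another chart the field has components [D_v] of the transition map,
    read through the inverse transition map. *)
Lemma smooth_coord_vfield a U (v : 'rV[R]_m) : open U -> U `<=` chart_dom a ->
  smooth_vfield U (coord_vfield a v).
Proof.
move=> oU Ua b.
have oA := chart_image_setI_open (a := b) oU.
apply: (smooth_on_eq oA (f := 'D_v (transition a b) \o transition b a)).
  move=> _ [q [bq /Ua aq] <-]; rewrite vfield_coord_coord //.
  by rewrite /= transitionE.
apply: (smooth_on_comp oA (B := chart a @` (chart_dom a `&` chart_dom b))).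
- exact/chart_image_setI_open/chart_dom_open.
- apply: smooth_on_sub (@chart_compat _ _ M b a) => _ [q [bq /Ua aq] <-].
  by exists q.
- move=> _ [q [bq /Ua aq] <-]; rewrite transitionE //; by exists q.
- exact/smooth_on_derive/chart_compat.
Qed.

Lemma smooth_fun_cst U (k : R) : open U -> smooth_fun U (fun=> k).
Proof.
move=> oU a; apply: (smooth_on_cst k); exact: chart_image_setI_open.
Qed.

Lemma smooth_vfieldD U X Y : open U -> smooth_vfield U X -> smooth_vfield U Y ->
  smooth_vfield U (fun q => X q + Y q).
Proof.
move=> oU sX sY a; have oA := chart_image_setI_open (a := a) oU.
apply: (smooth_on_eq oA _ (smooth_onDv oA (sX a) (sY a))) => x _.
by rewrite /vfield_coord /chart_change linearD.
Qed.

Lemma smooth_vfieldZ U h X : open U -> smooth_fun U h -> smooth_vfield U X ->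
  smooth_vfield U (fun q => h q *: X q).
Proof.
move=> oU sh sX a; have oA := chart_image_setI_open (a := a) oU.
apply: (smooth_on_eq oA _ (smooth_onZv oA (sh a) (sX a))) => x _.
by rewrite /vfield_coord /chart_change linearZ.
Qed.

Lemma smooth_vfieldZc U (k : R) X : open U -> smooth_vfield U X ->
  smooth_vfield U (fun q => k *: X q).
Proof. by move=> oU sX; apply: smooth_vfieldZ => //; exact: smooth_fun_cst. Qed.

Lemma smooth_vfield_sub U U' X : U `<=` U' -> smooth_vfield U' X -> smooth_vfield U X.
Proof.
move=> UU sX a; apply: smooth_on_sub (sX a) => _ [q [aq /UU qU] <-].
by exists q.
Qed.

Lemma smooth_fun_diff U h a q : smooth_fun U h -> chart_dom a q -> U q ->
  differentiable (h \o chart_inv a) (chart a q).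
Proof.
move=> sh aq Uq.
have xA : (chart a @` (chart_dom a `&` U)) (chart a q) by exists q.
exact: smooth_on_diff (sh a) xA.
Qed.

Definition component a X (j : 'I_m) : M -> R :=
  fun q => vfield_coord a X (chart a q) 0 j.

Lemma smooth_component a U X j : open U -> U `<=` chart_dom a ->
  smooth_vfield U X -> smooth_fun U (component a X j).
Proof.
move=> oU Ua sX b; have oA := chart_image_setI_open (a := b) oU.
have oB := chart_image_setI_open (a := a) oU.
have sj : smooth_on (chart a @` (chart_dom a `&` U))
    (fun y => vfield_coord a X y 0 j).
  by move/smooth_on_coord: (sX a) => /(_ oB).
apply: (smooth_on_comp1 oA (f := transition b a) _ _ sj).
- apply: smooth_on_sub (@chart_compat _ _ M b a) => _ [q [bq /Ua aq] <-].
  by exists q.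
- move=> _ [q [bq Uq] <-]; rewrite transitionE //; exists q => //.
  by split => //; exact: Ua.
Qed.

Lemma component_expansion a X q : chart_dom a q ->
  X q = \sum_(j < m) component a X j q *: coord_vfield a (delta_mx 0 j) q.
Proof.
move=> aq; have pq := chart_dom_center q.
rewrite -{1}(chart_changeK (X q) pq aq) -vfield_coordE //.
rewrite [X in chart_change _ _ _ X]row_sum_delta /chart_change linear_sum.
by apply: eq_bigr => j _; rewrite linearZ.
Qed.

Lemma vderivE a U X h q : smooth_fun U h -> U q -> chart_dom a q ->
  vderiv X h q
  = 'd (h \o chart_inv a) (chart a q) (vfield_coord a X (chart a q)).
Proof.
move=> sh Uq aq; have qq := chart_dom_center q.
rewrite /vderiv vfield_coordE //.
by have [_ E] := diff_chart_swap (X q) qq aq (smooth_fun_diff sh aq Uq); rewrite [LHS]E.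
Qed.

Lemma vderiv_coord a U h q (v : 'rV[R]_m) : smooth_fun U h -> U q ->
  chart_dom a q ->
  vderiv (coord_vfield a v) h q = 'D_v (h \o chart_inv a) (chart a q).
Proof.
move=> sh Uq aq; rewrite (vderivE _ sh Uq aq) vfield_coordE // chart_changeK //.
  by rewrite deriveE //; exact: smooth_fun_diff sh aq Uq.
exact: chart_dom_center.
Qed.

Lemma vderiv_cst X (k : R) q : vderiv X (fun=> k) q = 0.
Proof.
rewrite /vderiv (_ : _ \o _ = cst k); last by [].
by rewrite diff_cst.
Qed.

Lemma smooth_vderiv_coord a U h (v : 'rV[R]_m) : open U -> U `<=` chart_dom a ->
  smooth_fun U h -> smooth_on (chart a @` (chart_dom a `&` U))
   (vderiv (coord_vfield a v) h \o chart_inv a).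
Proof.
move=> oU Ua sh; have oA := chart_image_setI_open (a := a) oU.
apply: (smooth_on_eq oA _ (smooth_on_derive v (sh a))) => _ [q [aq Uq] <-] /=.
by rewrite chartK // (vderiv_coord v sh Uq aq).
Qed.

(** In the chart both sides are second partial derivatives of the same function. *)
Lemma vderiv_coord_comm a U h (v w : 'rV[R]_m) : open U -> U a ->
  U `<=` chart_dom a -> smooth_fun U h ->
  vderiv (coord_vfield a v) (vderiv (coord_vfield a w) h) a
  = vderiv (coord_vfield a w) (vderiv (coord_vfield a v) h) a.
Proof.
move=> oU Ua UA sh; have aa := chart_dom_center a.
have oA := chart_image_setI_open (a := a) oU.
have xA : (chart a @` (chart_dom a `&` U)) (chart a a) by exists a.
have E u u' : vderiv (coord_vfield a u) (vderiv (coord_vfield a u') h) a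
   = 'D_u ('D_u' (h \o chart_inv a)) (chart a a).
  rewrite {1}/vderiv coord_vfield_center -deriveE; last first.
    exact: smooth_on_diff (smooth_vderiv_coord u' oU UA sh) xA.
  apply: near_eq_derive; apply: (open_near_eq oA xA) => _ [q [aq Uq] <-] /=.
  by rewrite chartK // (vderiv_coord u' sh Uq aq).
apply: (etrans (E _ _)); apply: (etrans _ (esym (E _ _))).
apply: (derive_symmetric oA xA) => [y||].
- exact: smooth_on_diff (sh a).
- exact: smooth_on_diff (smooth_on_derive _ (sh a)) xA.
- exact: smooth_on_diff (smooth_on_derive _ (sh a)) xA.
Qed.

(** At [q] the bracket is computed in the chart at [q]: it is the difference of
    the second derivatives of the transition map from [a] to [q] in the two
    orders. *)
Lemma lie_bracket_coord a q (v w : 'rV[R]_m) : chart_dom a q ->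
  lie_bracket (coord_vfield a v) (coord_vfield a w) q = 0.
Proof.
move=> aq; have qq := chart_dom_center q.
have oA := chart_image_setI_open (a := a) (chart_dom_open q).
have xA : (chart a @` (chart_dom a `&` chart_dom q)) (chart a q) by exists q.
have E u u' : 'd (vfield_coord q (coord_vfield a u)) (chart q q) (coord_vfield a u' q)
   = 'D_u' ('D_u (transition a q)) (chart a q).
  have dF : differentiable ('D_u (transition a q)) (transition q a (chart q q)).
    rewrite transitionE //.
    exact: smooth_on_diff (smooth_on_derive u (@chart_compat _ _ M a q)) xA.
  have dT := transition_diff qq aq.
  have n : \forall x \near chart q q,
     ('D_u (transition a q) \o transition q a) x = vfield_coord q (coord_vfield a u) x.
    apply: filterS (chart_image_near qq (chart_dom_open a) aq) => _ [q' [qq' aq'] <-] /=.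
    by rewrite transitionE // vfield_coord_coord.
  have [_ E] := diff_near_eq n (differentiable_comp dT dF).
  rewrite [LHS]E [LHS](diff_compE _ dT dF).
  have Eu : 'd (transition q a) (chart q q) (coord_vfield a u' q) = u'.
    exact: chart_changeK.
  apply: (etrans (congr1 _ Eu)); apply: (etrans (esym (deriveE u' dF))).
  by rewrite (transitionE _ qq); reflexivity.
rewrite /lie_bracket; apply/eqP; rewrite subr_eq0; apply/eqP.
apply: (etrans (E _ _)); apply: (etrans _ (esym (E _ _))).
exact: (smooth_on_derive_symmetric _ _ oA xA (@chart_compat _ _ M a q)).
Qed.

End charts.

Section differentiable_at.
Context {R : realType} {m : nat} {M : manifold R m}.
Implicit Types (p q : M) (U : set M) (X : vfield M) (h k : M -> R).

(** Differentiability in the preferred chart.  Unlike smoothness it is required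
    at a single point, which suffices to differentiate determinants and
    quotients there. *)
Definition diff_at h q := differentiable (h \o chart_inv q) (chart q q).

Lemma smooth_fun_diff_at U h q : smooth_fun U h -> U q -> diff_at h q.
Proof. by move=> sh Uq; apply: (smooth_fun_diff sh _ Uq); exact: chart_dom_center. Qed.

Lemma diff_at_cst (c : R) q : diff_at (fun=> c) q.
Proof. exact: (differentiable_cst c). Qed.

Lemma diff_atD h k q : diff_at h q -> diff_at k q -> diff_at (fun x => h x + k x) q.
Proof. by move=> dh dk; exact: (differentiableD dh dk). Qed.

Lemma diff_atM h k q : diff_at h q -> diff_at k q -> diff_at (fun x => h x * k x) q.
Proof. by move=> dh dk; exact: (differentiableM dh dk). Qed.

Lemma diff_atV h q : diff_at h q -> h q != 0 -> diff_at (fun x => (h x)^-1) q.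
Proof.
move=> dh hq; apply: (differentiableV dh).
by rewrite /= chartK //; exact: chart_dom_center.
Qed.

Lemma vderiv_atD X h k q : diff_at h q -> diff_at k q ->
  vderiv X (fun x => h x + k x) q = vderiv X h q + vderiv X k q.
Proof. by move=> dh dk; rewrite /vderiv [LHS](congr1 (fun f => f _) (diffD dh dk)). Qed.

Lemma vderiv_atM X h k q : diff_at h q -> diff_at k q ->
  vderiv X (fun x => h x * k x) q = h q * vderiv X k q + k q * vderiv X h q.
Proof.
move=> dh dk; rewrite /vderiv [LHS](congr1 (fun f => f _) (diffM dh dk)) /=.
by rewrite chartK //; exact: chart_dom_center.
Qed.

Lemma vderiv_atZ X c h q : diff_at h q ->
  vderiv X (fun x => c * h x) q = c * vderiv X h q.
Proof.
move=> dh; rewrite (vderiv_atM X (diff_at_cst c q) dh).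
by rewrite vderiv_cst mulr0 addr0.
Qed.

Lemma diff_at_sum (I : Type) (r : seq I) (P : pred I) (h : I -> M -> R) q :
  (forall i, diff_at (h i) q) -> diff_at (fun x => \sum_(i <- r | P i) h i x) q.
Proof.
move=> dh; elim: r => [|i r IH].
  rewrite (_ : (fun x => _) = fun=> 0); first exact: diff_at_cst.
  by apply/funext => x; rewrite big_nil.
have [Pi|Pi] := boolP (P i).
  rewrite (_ : (fun x => _) = fun x => h i x + \sum_(j <- r | P j) h j x).
    exact: diff_atD.
  by apply/funext => x; rewrite big_cons Pi.
rewrite (_ : (fun x => _) = fun x => \sum_(j <- r | P j) h j x) //.
by apply/funext => x; rewrite big_cons (negbTE Pi).
Qed.

Lemma diff_at_prod (I : Type) (r : seq I) (h : I -> M -> R) q :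
  (forall i, diff_at (h i) q) -> diff_at (fun x => \prod_(i <- r) h i x) q.
Proof.
move=> dh; elim: r => [|i r IH].
  rewrite (_ : (fun x => _) = fun=> 1); first exact: diff_at_cst.
  by apply/funext => x; rewrite big_nil.
rewrite (_ : (fun x => _) = fun x => h i x * \prod_(j <- r) h j x).
  exact: diff_atM.
by apply/funext => x; rewrite big_cons.
Qed.

Lemma vderiv_at_sum X n (h : 'I_n -> M -> R) q : (forall i, diff_at (h i) q) ->
  vderiv X (fun x => \sum_(i < n) h i x) q = \sum_(i < n) vderiv X (h i) q.
Proof.
elim: n h => [|n IH] h dh.
  rewrite big_ord0 -[RHS](vderiv_cst X 0 q); congr (vderiv _ _ _).
  by apply/funext => x; rewrite big_ord0.
rewrite (_ : (fun x => _) = fun x => h ord0 x + \sum_(i < n) h (lift ord0 i) x).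
  rewrite vderiv_atD ?IH ?big_ord_recl //; exact: diff_at_sum.
by apply/funext => x; rewrite big_ord_recl.
Qed.

Lemma diff_at_det n (B : M -> 'M[R]_n) q : (forall i j, diff_at (fun x => B x i j) q) ->
  diff_at (fun x => \det (B x)) q.
Proof.
move=> dB; apply: diff_at_sum => s; apply: diff_atM; first exact: diff_at_cst.
by apply: diff_at_prod.
Qed.

Lemma diff_at_adj n (B : M -> 'M[R]_n) q i j :
  (forall i j, diff_at (fun x => B x i j) q) ->
  diff_at (fun x => \adj (B x) i j) q.
Proof.
move=> dB; rewrite (_ : (fun x => _) =
   fun x => (-1) ^+ (j + i) * \det (row' j (col' i (B x)))).
  apply: diff_atM; first exact: diff_at_cst.
  apply: diff_at_det => k l.
  rewrite (_ : (fun x => _) = fun x => B x (lift j k) (lift i l)) //.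
  by apply/funext => x; rewrite !mxE.
by apply/funext => x; rewrite mxE.
Qed.

Lemma vderiv_at_local U h k q : open U -> U q -> (forall x, U x -> h x = k x) ->
  diff_at h q -> diff_at k q /\ forall X, vderiv X k q = vderiv X h q.
Proof.
move=> oU Uq hk dh; have qq := chart_dom_center q.
have n : \forall x \near chart q q, (h \o chart_inv q) x = (k \o chart_inv q) x.
  apply: filterS (chart_image_near qq oU Uq) => _ [q' [qq' Uq'] <-] /=.
  by rewrite chartK // hk.
have [d1 E] := diff_near_eq n dh.
by split=> // X; rewrite /vderiv [LHS]E.
Qed.

Lemma smooth_fun_eq U h k : open U ->
  (forall x, U x -> h x = k x) -> smooth_fun U h -> smooth_fun U k.
Proof.
move=> oU hk sh a; have oA := chart_image_setI_open (a := a) oU.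
apply: (smooth_on_eq oA _ (sh a)) => _ [q [aq Uq] <-] /=.
by rewrite chartK // hk.
Qed.

End differentiable_at.

(** * Tensoriality and symmetries of the curvature *)

Section metric_facts.
Context {R : realType} {m : nat} {M : riemannian R m}.
Implicit Types q : M.

Lemma inner_form q v : linear_form (inner q ^~ v).
Proof. by move=> c x y; rewrite inner_linear. Qed.

Lemma inner_form_r q v : linear_form (inner q v).
Proof. exact: g_linear_r (inner_form q) (inner_sym q) v. Qed.

End metric_facts.

Section connection.
Context {R : realType} {m : nat} {M : riemannian R m}.
Variable nabla : vfield M -> vfield M -> vfield M.
Hypothesis LC : levi_civita nabla.
Implicit Types (p q : M) (U : set M) (X Y Z W : vfield M) (h : M -> R).

Let C : is_connection nabla := levi_civita_connection LC.

Lemma nabla_smooth U X Y : open U -> smooth_vfield U X -> smooth_vfield U Y ->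
  smooth_vfield U (nabla X Y).
Proof. by move=> oU sX sY; exact: (@connection_smooth _ _ _ _ C U X Y oU sX sY). Qed.

Lemma nabla_local U X X' Y Y' q : open U -> U q -> smooth_vfield U X ->
  smooth_vfield U Y -> (forall q', U q' -> X q' = X' q') ->
  (forall q', U q' -> Y q' = Y' q') -> nabla X Y q = nabla X' Y' q.
Proof.
move=> oU Uq sX sY XX YY; apply: (connection_local C oU sX sY); last exact/mem_set.
  by move=> q' /set_mem; exact: XX.
by move=> q' /set_mem; exact: YY.
Qed.

Lemma nablaDl U X X' Y q : open U -> U q -> smooth_vfield U X ->
  smooth_vfield U X' -> smooth_vfield U Y ->
  nabla (fun q => X q + X' q) Y q = nabla X Y q + nabla X' Y q.
Proof.
by move=> oU Uq sX sX' sY; apply: (connection_addl C oU sX sX' sY); exact/mem_set.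
Qed.

Lemma nablaDr U X Y Y' q : open U -> U q -> smooth_vfield U X ->
  smooth_vfield U Y -> smooth_vfield U Y' ->
  nabla X (fun q => Y q + Y' q) q = nabla X Y q + nabla X Y' q.
Proof.
by move=> oU Uq sX sY sY'; apply: (connection_addr C oU sX sY sY'); exact/mem_set.
Qed.

Lemma nablaZl U h X Y q : open U -> U q -> smooth_fun U h ->
  smooth_vfield U X -> smooth_vfield U Y ->
  nabla (fun q => h q *: X q) Y q = h q *: nabla X Y q.
Proof.
by move=> oU Uq sh sX sY; apply: (connection_scalel C oU sh sX sY); exact/mem_set.
Qed.

Lemma nabla_leibniz U h X Y q : open U -> U q -> smooth_fun U h ->
  smooth_vfield U X -> smooth_vfield U Y ->
  nabla X (fun q => h q *: Y q) q = vderiv X h q *: Y q + h q *: nabla X Y q.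
Proof.
by move=> oU Uq sh sX sY; apply: (connection_leibniz C oU sh sX sY); exact/mem_set.
Qed.

Lemma nabla_metric U X Y Z q : open U -> U q -> smooth_vfield U X ->
  smooth_vfield U Y -> smooth_vfield U Z ->
  vderiv X (fun q => inner q (Y q) (Z q)) q
  = inner q (nabla X Y q) (Z q) + inner q (Y q) (nabla X Z q).
Proof.
by move=> oU Uq sX sY sZ; apply: (levi_civita_metric LC oU sX sY sZ); exact/mem_set.
Qed.

Lemma nabla_torsion_free U X Y q : open U -> U q -> smooth_vfield U X ->
  smooth_vfield U Y -> nabla X Y q - nabla Y X q = lie_bracket X Y q.
Proof.
by move=> oU Uq sX sY; apply: (levi_civita_torsion_free LC oU sX sY); exact/mem_set.
Qed.

Lemma nablaZcl U k X Y q : open U -> U q ->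
  smooth_vfield U X -> smooth_vfield U Y ->
  nabla (fun q => k *: X q) Y q = k *: nabla X Y q.
Proof.
by move=> oU Uq sX sY; rewrite (nablaZl oU Uq (smooth_fun_cst k oU) sX sY).
Qed.

Lemma nablaZcr U k X Y q : open U -> U q ->
  smooth_vfield U X -> smooth_vfield U Y ->
  nabla X (fun q => k *: Y q) q = k *: nabla X Y q.
Proof.
move=> oU Uq sX sY; rewrite (nabla_leibniz oU Uq (smooth_fun_cst k oU) sX sY).
by rewrite vderiv_cst scale0r add0r.
Qed.

Lemma smooth_vfieldB U X Y : open U -> smooth_vfield U X -> smooth_vfield U Y ->
  smooth_vfield U (fun q => X q - Y q).
Proof.
move=> oU sX sY.
rewrite (_ : (fun q => _) = fun q => X q + (-1) *: Y q); last first.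
  by apply/funext => q; rewrite scaleN1r.
by apply: smooth_vfieldD => //; exact: smooth_vfieldZc.
Qed.

Lemma nablaBr U X Y Y' q : open U -> U q -> smooth_vfield U X ->
  smooth_vfield U Y -> smooth_vfield U Y' ->
  nabla X (fun q => Y q - Y' q) q = nabla X Y q - nabla X Y' q.
Proof.
move=> oU Uq sX sY sY'.
rewrite (_ : (fun q => _) = fun q => Y q + (-1) *: Y' q); last first.
  by apply/funext => q'; rewrite scaleN1r.
rewrite (nablaDr oU Uq sX sY (smooth_vfieldZc _ oU sY')).
by rewrite (nablaZcr _ oU Uq sX sY') scaleN1r.
Qed.

Lemma smooth_vfield0 U X : open U -> smooth_vfield U X ->
  smooth_vfield U ((fun=> 0) : vfield M).
Proof.
move=> oU sX; have := smooth_vfieldZc 0 oU sX.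
by congr (smooth_vfield _ _); apply/funext => q; rewrite scale0r.
Qed.

Lemma nabla0l U Y q : open U -> U q -> smooth_vfield U Y ->
  nabla (fun=> 0) Y q = 0.
Proof.
move=> oU Uq sY; apply: etrans (etrans (nablaZcl 0 oU Uq sY sY) (scale0r _)).
by congr (nabla _ _ _); apply/funext => q'; rewrite scale0r.
Qed.

Lemma nabla0r U X q : open U -> U q -> smooth_vfield U X ->
  nabla X (fun=> 0) q = 0.
Proof.
move=> oU Uq sX; apply: etrans (etrans (nablaZcr 0 oU Uq sX sX) (scale0r _)).
by congr (nabla _ _ _); apply/funext => q'; rewrite scale0r.
Qed.

Lemma smooth_vfield_sum U X0 n (V : 'I_n -> vfield M) : open U ->
  smooth_vfield U X0 -> (forall j, smooth_vfield U (V j)) ->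
  smooth_vfield U (fun q => \sum_(j < n) V j q).
Proof.
move=> oU s0; elim: n V => [|n IH] V sV.
  rewrite (_ : (fun q => _) = fun=> 0); last by apply/funext => q; rewrite big_ord0.
  exact: smooth_vfield0 oU s0.
rewrite (_ : (fun q => _) = fun q => V ord0 q + \sum_(j < n) V (lift ord0 j) q).
  by apply: smooth_vfieldD => //; apply: IH.
by apply/funext => q; rewrite big_ord_recl.
Qed.

Lemma nabla_suml U n (V : 'I_n -> vfield M) Y q : open U -> U q ->
  (forall j, smooth_vfield U (V j)) -> smooth_vfield U Y ->
  nabla (fun q => \sum_(j < n) V j q) Y q = \sum_(j < n) nabla (V j) Y q.
Proof.
move=> oU Uq + sY; elim: n V => [|n IH] V sV.
  rewrite big_ord0 -[RHS](nabla0l oU Uq sY); congr (nabla _ _ _).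
  by apply/funext => q'; rewrite big_ord0.
rewrite (_ : (fun q => _) = fun q => V ord0 q + \sum_(j < n) V (lift ord0 j) q).
  have s1 := smooth_vfield_sum oU sY (fun j => sV (lift ord0 j)).
  rewrite (nablaDl oU Uq (sV _) s1 sY).
  by rewrite IH // big_ord_recl.
by apply/funext => q'; rewrite big_ord_recl.
Qed.

Lemma nabla_sumr U n (V : 'I_n -> vfield M) X q : open U -> U q ->
  smooth_vfield U X -> (forall j, smooth_vfield U (V j)) ->
  nabla X (fun q => \sum_(j < n) V j q) q = \sum_(j < n) nabla X (V j) q.
Proof.
move=> oU Uq sX; elim: n V => [|n IH] V sV.
  rewrite big_ord0 -[RHS](nabla0r oU Uq sX); congr (nabla _ _ _).
  by apply/funext => q'; rewrite big_ord0.
rewrite (_ : (fun q => _) = fun q => V ord0 q + \sum_(j < n) V (lift ord0 j) q).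
  have s1 := smooth_vfield_sum oU sX (fun j => sV (lift ord0 j)).
  rewrite (nablaDr oU Uq sX (sV _) s1).
  by rewrite IH // big_ord_recl.
by apply/funext => q'; rewrite big_ord_recl.
Qed.

Section at_point.
Variables (U : set M) (q : M).
Hypotheses (oU : open U) (Uq : U q) (Udom : U `<=` chart_dom q).

Local Notation E := (coord_vfield q).
Local Notation e j := (delta_mx 0 j : 'rV[R]_m).

Lemma smooth_coord (v : 'rV[R]_m) : smooth_vfield U (E v).
Proof. exact: smooth_coord_vfield. Qed.

Lemma component_center X j : component q X j q = X q 0 j.
Proof.
rewrite /component vfield_coordE ?chart_change_id //; exact: chart_dom_center.
Qed.

(** The first argument of a connection enters through its values only. *)
Lemma nabla_component X Y q' : U q' -> smooth_vfield U X -> smooth_vfield U Y ->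
  nabla X Y q' = \sum_(j < m) component q X j q' *: nabla (E (e j)) Y q'.
Proof.
move=> Uq' sX sY.
have sh j := smooth_component j oU Udom sX.
have s j := smooth_vfieldZ oU (sh j) (smooth_coord (e j)).
rewrite (nabla_local (X' := fun q0 =>
  \sum_(j < m) component q X j q0 *: E (e j) q0) (Y' := Y) oU Uq' sX sY) //.
  rewrite (nabla_suml oU Uq' s sY); apply: eq_bigr => j _.
  by rewrite (nablaZl oU Uq' (sh j) (smooth_coord (e j)) sY).
by move=> q0 Uq0; apply: component_expansion; exact: Udom.
Qed.

Lemma nabla_center X Y : smooth_vfield U X -> smooth_vfield U Y ->
  nabla X Y q = \sum_(j < m) X q 0 j *: nabla (E (e j)) Y q.
Proof.
move=> sX sY; rewrite (nabla_component Uq sX sY).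
by apply: eq_bigr => j _; rewrite component_center.
Qed.

Lemma nabla_pointwise X X' Y : smooth_vfield U X -> smooth_vfield U X' ->
  smooth_vfield U Y -> X q = X' q -> nabla X Y q = nabla X' Y q.
Proof.
by move=> sX sX' sY XX; rewrite (nabla_center sX sY) (nabla_center sX' sY) XX.
Qed.

(** For a torsion-free connection this is the Lie bracket.  Written in this
    form, its behaviour under multiplication by functions follows from the
    axioms of a connection. *)
Definition torsion_bracket X Y : vfield M := fun q => nabla X Y q - nabla Y X q.

Lemma curvature_vfieldE X Y Z q' : U q' ->
  smooth_vfield U X -> smooth_vfield U Y -> smooth_vfield U Z ->
  curvature_vfield nabla X Y Z q'
  = nabla X (nabla Y Z) q' - nabla Y (nabla X Z) q'
    - nabla (torsion_bracket X Y) Z q'.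
Proof.
move=> Uq' sX sY sZ; rewrite /curvature_vfield; congr (_ - _).
apply: esym; apply: (nabla_local oU Uq') => // [|q0 Uq0].
  by apply: smooth_vfieldB => //; exact: nabla_smooth.
exact: (nabla_torsion_free oU Uq0 sX sY).
Qed.

Lemma smooth_torsion_bracket X Y : smooth_vfield U X -> smooth_vfield U Y ->
  smooth_vfield U (torsion_bracket X Y).
Proof. by move=> sX sY; apply: smooth_vfieldB => //; exact: nabla_smooth. Qed.

Lemma curvature_anti X Y Z :
  smooth_vfield U X -> smooth_vfield U Y -> smooth_vfield U Z ->
  curvature_vfield nabla Y X Z q = - curvature_vfield nabla X Y Z q.
Proof.
move=> sX sY sZ; rewrite !curvature_vfieldE //.
rewrite (_ : torsion_bracket Y X = fun q => (-1) *: torsion_bracket X Y q).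
  rewrite (nablaZcl _ oU Uq) //; last exact: smooth_torsion_bracket.
  by rewrite scaleN1r !opprB opprK addrC.
by apply/funext => q0; rewrite scaleN1r opprB.
Qed.

(** Tensoriality in the first argument.  Expanding [X] in the coordinate frame,
    the derivatives of its coefficients appear once in [nabla Y (nabla X Z)]
    and once in the bracket term, and cancel. *)
Lemma curvature_center X Y Z :
  smooth_vfield U X -> smooth_vfield U Y -> smooth_vfield U Z ->
  curvature_vfield nabla X Y Z q
  = \sum_(j < m) X q 0 j *: curvature_vfield nabla (E (e j)) Y Z q.
Proof.
move=> sX sY sZ; have sE := smooth_coord.
under eq_bigr do rewrite curvature_vfieldE //.
rewrite curvature_vfieldE //.
have sh j := smooth_component j oU Udom sX.
have s1 : nabla X (nabla Y Z) q
   = \sum_(j < m) X q 0 j *: nabla (E (e j)) (nabla Y Z) q.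
  by apply: nabla_center => //; exact: nabla_smooth.
have s2 : nabla Y (nabla X Z) q = \sum_(j < m)
   (vderiv Y (component q X j) q *: nabla (E (e j)) Z q
    + X q 0 j *: nabla Y (nabla (E (e j)) Z) q).
  have sj j : smooth_vfield U (nabla (E (e j)) Z) by exact: nabla_smooth.
  rewrite (nabla_local (X' := Y) (Y' := fun q0 =>
    \sum_(j < m) component q X j q0 *: nabla (E (e j)) Z q0) oU Uq sY) //.
  - rewrite (nabla_sumr oU Uq sY) => [|j]; last exact: smooth_vfieldZ.
    apply: eq_bigr => j _; rewrite (nabla_leibniz oU Uq (sh j) sY) //.
    by rewrite component_center.
  - exact: nabla_smooth.
  - by move=> q0 Uq0; exact: nabla_component.
have s3 : nabla (torsion_bracket X Y) Z q = \sum_(j < m)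
   (X q 0 j *: nabla (torsion_bracket (E (e j)) Y) Z q
    - vderiv Y (component q X j) q *: nabla (E (e j)) Z q).
  have sT j : smooth_vfield U (fun q0 => X q 0 j *: torsion_bracket (E (e j)) Y q0).
    by apply: smooth_vfieldZc => //; exact: smooth_torsion_bracket.
  have sV j : smooth_vfield U (fun q0 => vderiv Y (component q X j) q *: E (e j) q0).
    by exact: smooth_vfieldZc.
  have sTV j : smooth_vfield U (fun q0 => X q 0 j *: torsion_bracket (E (e j)) Y q0
      - vderiv Y (component q X j) q *: E (e j) q0).
    exact: smooth_vfieldB.
  rewrite (nabla_pointwise (X' := fun q0 => \sum_(j < m)
    (X q 0 j *: torsion_bracket (E (e j)) Y q0
      - vderiv Y (component q X j) q *: E (e j) q0))) //.
  - rewrite (nabla_suml oU Uq) //; apply: eq_bigr => j _.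
    rewrite (_ : (fun q0 => _) = fun q0 => X q 0 j *: torsion_bracket (E (e j)) Y q0
      + (- vderiv Y (component q X j) q) *: E (e j) q0); last first.
      by apply/funext => q0; rewrite scaleNr.
    rewrite (nablaDl oU Uq) //; last exact: smooth_vfieldZc.
    rewrite !(nablaZcl _ oU Uq) //; first by rewrite scaleNr.
    exact: smooth_torsion_bracket.
  - exact: smooth_torsion_bracket.
  - exact: smooth_vfield_sum oU sX sTV.
  - rewrite {1}/torsion_bracket (nabla_center sX sY).
    have -> : nabla Y X q = \sum_(j < m)
       (vderiv Y (component q X j) q *: E (e j) q + X q 0 j *: nabla Y (E (e j)) q).
      rewrite (nabla_local (X' := Y) (Y' := fun q0 =>
        \sum_(j < m) component q X j q0 *: E (e j) q0) oU Uq sY) //.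
        rewrite (nabla_sumr oU Uq sY) => [|j]; last exact: smooth_vfieldZ.
        apply: eq_bigr => j _; rewrite (nabla_leibniz oU Uq (sh j) sY) //.
        by rewrite component_center.
      by move=> q0 Uq0; apply: component_expansion; exact: Udom.
    rewrite -sumrB; apply: eq_bigr => j _.
    by rewrite /torsion_bracket scalerBr opprD addrA addrAC.
rewrite s1 s2 s3 -!sumrB; apply: eq_bigr => j _.
rewrite !scalerBr.
set a := _ *: _; set b := _ *: _; set c := _ *: _; set d := _ *: _.
clearbody a b c d; apply/rowP => i; rewrite !mxE; ring.
Qed.

Lemma curvature_pointwise_l X X' Y Z :
  smooth_vfield U X -> smooth_vfield U X' -> smooth_vfield U Y ->
  smooth_vfield U Z -> X q = X' q ->
  curvature_vfield nabla X Y Z q = curvature_vfield nabla X' Y Z q.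
Proof.
move=> sX sX' sY sZ XX.
by rewrite (curvature_center sX sY sZ) (curvature_center sX' sY sZ) XX.
Qed.

Lemma curvature_pointwise_lr X X' Y Y' Z :
  smooth_vfield U X -> smooth_vfield U X' -> smooth_vfield U Y ->
  smooth_vfield U Y' -> smooth_vfield U Z -> X q = X' q -> Y q = Y' q ->
  curvature_vfield nabla X Y Z q = curvature_vfield nabla X' Y' Z q.
Proof.
move=> sX sX' sY sY' sZ XX YY.
rewrite (curvature_pointwise_l sX sX' sY sZ XX).
rewrite (curvature_anti sY sX' sZ) (curvature_pointwise_l sY sY' sX' sZ YY).
by rewrite -(curvature_anti sY' sX' sZ).
Qed.

Lemma torsion_bracket_coord (v w : 'rV[R]_m) q' : U q' ->
  torsion_bracket (E v) (E w) q' = 0.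
Proof.
move=> Uq'; rewrite /torsion_bracket.
rewrite (nabla_torsion_free oU Uq') //; try exact: smooth_coord.
by apply: lie_bracket_coord; exact: Udom.
Qed.

Lemma nabla_coord_sym (v w : 'rV[R]_m) q' : U q' ->
  nabla (E v) (E w) q' = nabla (E w) (E v) q'.
Proof.
by move=> Uq'; apply/eqP; rewrite -subr_eq0; apply/eqP; exact: torsion_bracket_coord.
Qed.

Lemma curvature_coord (v w : 'rV[R]_m) Z q' : U q' -> smooth_vfield U Z ->
  curvature_vfield nabla (E v) (E w) Z q'
  = nabla (E v) (nabla (E w) Z) q' - nabla (E w) (nabla (E v) Z) q'.
Proof.
move=> Uq' sZ; have sE := smooth_coord.
rewrite (curvature_vfieldE Uq' (sE v) (sE w) sZ).
have s0 := smooth_torsion_bracket (sE v) (sE w).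
rewrite (nabla_local (X' := fun=> 0) (Y' := Z) oU Uq' s0 sZ) //.
  by rewrite (nabla0l oU Uq' sZ) subr0.
exact: torsion_bracket_coord.
Qed.

(** Metric compatibility expresses both sides through second derivatives of
    the function [inner (Z, W)], which commute along coordinate fields. *)
Lemma curvature_metric (v w : 'rV[R]_m) Z W :
  smooth_vfield U Z -> smooth_vfield U W ->
  inner q (curvature_vfield nabla (E v) (E w) Z q) (W q)
  = - inner q (Z q) (curvature_vfield nabla (E v) (E w) W q).
Proof.
move=> sZ sW; have sE := smooth_coord.
have sn u Z' : smooth_vfield U Z' -> smooth_vfield U (nabla (E u) Z').
  by move=> sZ'; exact: nabla_smooth.
(* The second derivative of [h] along two coordinate fields contains both
   terms to be compared and a part symmetric in the two fields. *)
pose h q' := inner q' (Z q') (W q').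
have sh : smooth_fun U h by exact: (inner_smooth oU sZ sW).
have H u1 u2 : vderiv (E u1) (vderiv (E u2) h) q
   = inner q (nabla (E u1) (nabla (E u2) Z) q) (W q)
     + inner q (nabla (E u2) Z q) (nabla (E u1) W q)
     + (inner q (nabla (E u1) Z q) (nabla (E u2) W q)
     + inner q (Z q) (nabla (E u1) (nabla (E u2) W) q)).
  have s1 : smooth_fun U (fun q' => inner q' (nabla (E u2) Z q') (W q')).
    exact: (inner_smooth oU (sn u2 _ sZ) sW).
  have s2 : smooth_fun U (fun q' => inner q' (Z q') (nabla (E u2) W q')).
    exact: (inner_smooth oU sZ (sn u2 _ sW)).
  rewrite -(nabla_metric oU Uq (sE u1) (sn u2 _ sZ) sW).
  rewrite -(nabla_metric oU Uq (sE u1) sZ (sn u2 _ sW)).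
  have d1 := smooth_fun_diff_at s1 Uq; have d2 := smooth_fun_diff_at s2 Uq.
  rewrite -(vderiv_atD _ d1 d2).
  apply: (proj2 (vderiv_at_local oU Uq _ (diff_atD d1 d2) )) => q' Uq'.
  by rewrite (nabla_metric oU Uq' (sE u2) sZ sW).
have := vderiv_coord_comm v w oU Uq Udom sh.
rewrite !H !curvature_coord // (linear_formB (inner_form q _)).
have S x y : inner q x y = inner q y x := inner_sym q x y.
rewrite (S (Z q) (_ - _)) (linear_formB (inner_form q _)).
rewrite !(S (nabla (E _) (nabla (E _) W) q) (Z q)) => K.
lra.
Qed.

End at_point.

Lemma nondegenerate q (x y : 'rV[R]_m) :
  (forall z, inner q x z = inner q y z) -> x = y.
Proof.
move=> H; apply/eqP; rewrite -subr_eq0; apply/negP => /negP/(inner_pos q).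
by rewrite (linear_formB (inner_form q _)) H subrr ltxx.
Qed.

(** Once the first two fields are replaced by coordinate fields of the chart at
    [q], skew-symmetry moves the third field out of the differentiated
    position, where only its value at [q] counts. *)
Lemma curvature_vfield_curv U q X Y Z : open U -> U q ->
  smooth_vfield U X -> smooth_vfield U Y -> smooth_vfield U Z ->
  curvature_vfield nabla X Y Z q = curv nabla q (X q) (Y q) (Z q).
Proof.
move=> oU0 Uq0 sX0 sY0 sZ0; pose U' := U `&` chart_dom q.
have oU : open U' by apply: openI => //; exact: chart_dom_open.
have Uq : U' q by split => //; exact: chart_dom_center.
have Ud : U' `<=` chart_dom q by move=> ? [].
have UU : U' `<=` U by move=> ? [].
have sX := smooth_vfield_sub UU sX0; have sY := smooth_vfield_sub UU sY0.
have sZ := smooth_vfield_sub UU sZ0.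
have sE v : smooth_vfield U' (coord_vfield q v) by exact: smooth_coord.
rewrite (curvature_pointwise_lr oU Uq Ud sX (sE (X q)) sY (sE (Y q)) sZ);
  rewrite ?coord_vfield_center //.
apply: (nondegenerate (q := q)) => z; rewrite -(coord_vfield_center q z) /curv.
rewrite (curvature_metric oU Uq Ud _ _ sZ (sE z)).
rewrite (curvature_metric oU Uq Ud _ _ (sE _) (sE z)).
by rewrite !coord_vfield_center.
Qed.

Definition curv4 q (v w u z : 'rV[R]_m) : R := inner q (curv nabla q v w u) z.

Section curv4_at_point.
Variable q : M.

Let U := chart_dom q.
Let oU : open U := chart_dom_open q.
Let Uq : U q := chart_dom_center q.
Let Ud : U `<=` chart_dom q. Proof. by []. Qed.
Let sE v : smooth_vfield U (coord_vfield q v).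
Proof. exact: smooth_coord oU Ud _. Qed.

Lemma curv4_linear v z u c v' z' :
  curv4 q (c *: v + v') z u z' = c * curv4 q v z u z' + curv4 q v' z u z'.
Proof.
rewrite /curv4 -inner_linear; congr (inner q _ _); rewrite /curv.
rewrite !(curvature_center oU Uq Ud (sE _) (sE z) (sE u)) scaler_sumr -big_split.
apply: eq_bigr => j _ /=.
by rewrite !coord_vfield_center !mxE scalerDl scalerA.
Qed.

Lemma curv4_anti12 v w u z : curv4 q v w u z = - curv4 q w v u z.
Proof.
rewrite /curv4 /curv (curvature_anti oU Uq (sE w) (sE v) (sE u)).
by rewrite -scaleN1r (linear_formZ (inner_form q z)) mulN1r.
Qed.

Lemma curv4_anti34 v w u z : curv4 q v w u z = - curv4 q v w z u.
Proof.
rewrite /curv4 /curv -{1}(coord_vfield_center q z).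
rewrite (curvature_metric oU Uq Ud v w (sE u) (sE z)).
by rewrite inner_sym coord_vfield_center.
Qed.

(** First Bianchi identity: coordinate fields commute, so the torsion-free
    condition makes the second covariant derivatives cancel in pairs. *)
Lemma curv4_bianchi v w u z :
  curv4 q v w u z + curv4 q w u v z + curv4 q u v w z = 0.
Proof.
have E : curv nabla q v w u + curv nabla q w u v + curv nabla q u v w = 0.
  rewrite /curv !(curvature_coord oU Ud _ _ Uq (sE _)).
  have S x y t : nabla (coord_vfield q x) (nabla (coord_vfield q y) (coord_vfield q t)) q
     = nabla (coord_vfield q x) (nabla (coord_vfield q t) (coord_vfield q y)) q.
    apply: (nabla_local oU Uq (sE _)) => // [|q' Uq'].
      exact: (nabla_smooth oU (sE _) (sE _)).
    exact: (nabla_coord_sym oU Ud).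
  rewrite (S v w u) (S w u v) (S u v w).
  set a := nabla _ _ q; set b := nabla _ _ q; set c := nabla _ _ q.
  clearbody a b c; apply/rowP => i; rewrite !mxE; ring.
have := congr1 (fun x => inner q x z) E; rewrite /= (linear_form0 (inner_form q z)).
by rewrite (linear_formD (inner_form q z)) (linear_formD (inner_form q z)).
Qed.

End curv4_at_point.

Lemma curv4_tensor q : curvature_tensor (curv4 q).
Proof.
split.
- by move=> w u z c v v'; rewrite curv4_linear.
- exact: curv4_anti12.
- exact: curv4_anti34.
- exact: curv4_bianchi.
Qed.

End connection.

(** * The second Bianchi identity *)

Section covariant_derivative_of_curvature.
Context {R : realType} {m : nat} {M : riemannian R m}.
Variable nabla : vfield M -> vfield M -> vfield M.
Hypothesis LC : levi_civita nabla.
Variable p : M.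

Local Notation E := (coord_vfield p).
Local Notation U := (chart_dom p).
Let oU : open U := chart_dom_open p.
Let Up : U p := chart_dom_center p.
Let UU : U `<=` U. Proof. by []. Qed.
Let sE (v : 'rV[R]_m) : smooth_vfield U (E v).
Proof. exact: smooth_coord oU UU v. Qed.

Definition christoffel (k i : 'rV[R]_m) : 'rV[R]_m := nabla (E k) (E i) p.

Definition curv_fun (i j l z : 'rV[R]_m) : M -> R :=
  fun q => curv4 nabla q (E i q) (E j q) (E l q) (E z q).

(** The value at [p] of the covariant derivative [(nabla_k R)(i, j, l, z)]. *)
Definition dcurv (k i j l z : 'rV[R]_m) : R :=
  vderiv (E k) (curv_fun i j l z) p
  - curv4 nabla p (christoffel k i) j l z - curv4 nabla p i (christoffel k j) l z
  - curv4 nabla p i j (christoffel k l) z - curv4 nabla p i j l (christoffel k z).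

Let K i j l : vfield M :=
  fun q => nabla (E i) (nabla (E j) (E l)) q - nabla (E j) (nabla (E i) (E l)) q.

Let sN i j : smooth_vfield U (nabla (E i) (E j)).
Proof. by apply: (nabla_smooth LC oU). Qed.

Let sNN k i j : smooth_vfield U (nabla (E k) (nabla (E i) (E j))).
Proof. by apply: (nabla_smooth LC oU). Qed.

Let sK i j l : smooth_vfield U (K i j l).
Proof. exact: smooth_vfieldB. Qed.

Let curv_funE i j l z q : U q -> inner q (K i j l q) (E z q) = curv_fun i j l z q.
Proof.
move=> Uq; rewrite /curv_fun /curv4.
rewrite -(curvature_vfield_curv LC oU Uq (sE i) (sE j) (sE l)).
by rewrite (curvature_coord LC oU UU _ _ Uq (sE l)).
Qed.

Lemma curv_fun_smooth i j l z : smooth_fun U (curv_fun i j l z).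
Proof.
apply: (smooth_fun_eq oU (curv_funE i j l z)).
exact: (inner_smooth oU (sK i j l) (sE z)).
Qed.

Lemma curv_fun_diff i j l z : diff_at (curv_fun i j l z) p.
Proof. exact: smooth_fun_diff_at (curv_fun_smooth i j l z) Up. Qed.

Lemma christoffel_sym i j : christoffel i j = christoffel j i.
Proof. exact: (nabla_coord_sym LC oU UU _ _ Up). Qed.

Lemma vderiv_inner k i j : vderiv (E k) (fun q => inner q (E i q) (E j q)) p
  = inner p (christoffel k i) j + inner p i (christoffel k j).
Proof.
by rewrite (nabla_metric LC oU Up (sE k) (sE i) (sE j)) !coord_vfield_center.
Qed.

(** The corrections by [christoffel] in the first two slots cancel in the
    cyclic sum because the connection is torsion free.  What is left is the
    Jacobi identity for commutators of the operators [nabla (E _)]. *)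
Lemma second_bianchi k i j l z :
  dcurv k i j l z + dcurv i j k l z + dcurv j k i l z = 0.
Proof.
pose N a b c := nabla (E a) (nabla (E b) (nabla (E c) (E l))) p.
have D a b c : dcurv a b c l z
   = inner p (N a b c - N a c b - (N b c a - N c b a)) z
     - curv4 nabla p (christoffel a b) c l z - curv4 nabla p b (christoffel a c) l z.
  have -> : inner p (N a b c - N a c b - (N b c a - N c b a)) z
     = inner p (nabla (E a) (K b c l) p) z - inner p (N b c a - N c b a) z.
    rewrite (linear_formB (inner_form p z)); congr (inner p _ z - _).
    by rewrite (nablaBr LC oU Up (sE a) (sNN b c l) (sNN c b l)).
  have -> : inner p (N b c a - N c b a) z = curv4 nabla p b c (christoffel a l) z.
    rewrite /curv4 /christoffel -{3}(coord_vfield_center p b).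
    rewrite -{3}(coord_vfield_center p c).
    rewrite -(curvature_vfield_curv LC oU Up (sE b) (sE c) (sN a l)).
    by rewrite (curvature_coord LC oU UU _ _ Up (sN a l)).
  rewrite /dcurv (proj2 (vderiv_at_local oU Up (curv_funE b c l z) _) (E a)); last first.
    exact: smooth_fun_diff_at (inner_smooth oU (sK b c l) (sE z)) Up.
  rewrite (nabla_metric LC oU Up (sE a) (sK b c l) (sE z)) coord_vfield_center.
  have -> : inner p (K b c l p) (nabla (E a) (E z) p)
     = curv4 nabla p b c l (christoffel a z).
    by rewrite /curv4 /curv (curvature_coord LC oU UU _ _ Up (sE l)).
  ring.
have A a b c : curv4 nabla p (christoffel a b) c l z
   = - curv4 nabla p c (christoffel b a) l z.
  by rewrite (curv4_anti12 LC) (christoffel_sym a b).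
rewrite !D !(linear_formB (inner_form p z)).
rewrite (A k i j) (A i j k) (A j k i); ring.
Qed.

End covariant_derivative_of_curvature.

(** * The differentiated Einstein condition *)

Section dcurv_symmetries.
Context {R : realType} {m : nat} {M : riemannian R m}.
Variable nabla : vfield M -> vfield M -> vfield M.
Hypothesis LC : levi_civita nabla.
Variable p : M.
Local Notation dcurv := (dcurv nabla p).
Local Notation curv_fun := (curv_fun nabla p).
Let T q : curvature_tensor (curv4 nabla q) := curv4_tensor LC q.

(** Covariant derivatives inherit the symmetries of the curvature tensor. *)
Lemma dcurv_anti12 k i j l z : dcurv k i j l z = - dcurv k j i l z.
Proof.
rewrite /dcurv (_ : curv_fun i j l z = fun q => (-1) * curv_fun j i l z q); last first.
  by apply/funext => q; rewrite mulN1r; exact: (ct_anti12 (T q)).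
rewrite vderiv_atZ; last exact: curv_fun_diff.
rewrite (ct_anti12 (T p) _ j) (ct_anti12 (T p) i (christoffel _ _ k j)).
rewrite (ct_anti12 (T p) i j (christoffel _ _ _ _)).
rewrite (ct_anti12 (T p) i j l); ring.
Qed.

Lemma dcurv_pair k i j l z : dcurv k i j l z = dcurv k l z i j.
Proof.
rewrite /dcurv (_ : curv_fun i j l z = curv_fun l z i j); last first.
  by apply/funext => q; exact: ct_pair (T q) _ _ _ _.
rewrite (ct_pair (T p) _ j) (ct_pair (T p) i (christoffel _ _ k j)).
rewrite (ct_pair (T p) i j (christoffel _ _ _ _)).
rewrite (ct_pair (T p) i j l); ring.
Qed.

Lemma dcurv_anti34 k i j l z : dcurv k i j l z = - dcurv k i j z l.
Proof. by rewrite dcurv_pair dcurv_anti12 dcurv_pair. Qed.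

End dcurv_symmetries.

Section schur_at_point.
Context {R : realType} {m : nat} {M : riemannian R m}.
Variable nabla : vfield M -> vfield M -> vfield M.
Hypothesis LC : levi_civita nabla.
Variable lam : M -> R.
Hypothesis lamP : forall q e w z, orthonormal_basis q e ->
  ricci_sum (curv4 nabla q) e w z = - (lam q * inner q w z).
Variable p : M.
Variable eps : 'I_m -> 'rV[R]_m.
Hypothesis oeps : orthonormal_basis p eps.

Local Notation E := (coord_vfield p).
Local Notation U := (chart_dom p).
Local Notation curv_fun := (curv_fun nabla p).
Local Notation gamma := (christoffel nabla p).
Let oU : open U := chart_dom_open p.
Let Up : U p := chart_dom_center p.
Let UU : U `<=` U. Proof. by []. Qed.
Let sE (v : 'rV[R]_m) : smooth_vfield U (E v).
Proof. exact: smooth_coord oU UU v. Qed.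
Let T q : curvature_tensor (curv4 nabla q) := curv4_tensor LC q.

Definition gram (q : M) : 'M[R]_m :=
  \matrix_(a, b) inner q (E (eps a) q) (E (eps b) q).

(** The coordinate fields form a frame on the whole chart domain, so their Gram
    matrix is invertible there. *)
Lemma gram_unit q : U q -> gram q \in unitmx.
Proof.
move=> Uq; rewrite -row_free_unit -kermx_eq0; apply/negPn/negP => /rowV0Pn[c].
move=> /sub_kermxP cG c0; case/negP: c0; apply/eqP.
pose v := \sum_a c 0 a *: eps a.
have Ev : E v q = \sum_a c 0 a *: E (eps a) q.
  rewrite /coord_vfield /chart_change linear_sum.
  by apply: eq_bigr => a _; rewrite linearZ.
have H b : inner q (E v q) (E (eps b) q) = 0.
  rewrite Ev (linear_form_comb (inner_form q _)).
  have : (c *m gram q) 0 b = 0 by rewrite cG mxE.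
  rewrite mxE => cGb; rewrite -[RHS]cGb.
  by apply: eq_bigr => a _; rewrite mxE.
have E0 : E v q = 0.
  apply/eqP/negPn/negP => /(inner_pos q); rewrite {2}Ev.
  rewrite (linear_form_comb (inner_form_r q _)) big1 ?ltxx // => a _.
  by rewrite H mulr0.
have v0 : v = 0.
  have qq := chart_dom_center q.
  by rewrite -(chart_changeK v Uq qq) -[chart_change p q q v]/(E v q) E0
      /chart_change linear0.
apply/rowP => a; rewrite mxE.
have := linear_form0 (inner_form p (eps a)); rewrite -v0.
rewrite (linear_form_comb (inner_form p _)) => <-.
rewrite -[LHS](sum_delta_l a (fun b => c 0 b)); apply: eq_bigr => b _.
by rewrite oeps mulrC.
Qed.

(** The Einstein condition in a frame that is orthonormal only at [p]: the
    trace is taken with the inverse Gram matrix, and the equation is multiplied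
    by the Gram determinant. *)
Lemma einstein_frame q c d : U q ->
  \sum_a \sum_b \adj (gram q) a b * curv_fun (eps a) c (eps b) d q
  = - (lam q * (\det (gram q) * inner q (E c q) (E d q))).
Proof.
move=> Uq.
have [f of_] := exists_orthonormal (inner_form q) (inner_sym q) (inner_pos q).
pose A : 'M[R]_m := \matrix_(a, i) inner q (E (eps a) q) (f i).
have GA : gram q = A *m A^T.
  apply/matrixP => a b; rewrite !mxE -(parseval (inner_form q) (inner_sym q) _ _ of_).
  by apply: eq_bigr => i _; rewrite !mxE.
have Au : A \in unitmx.
  by have := gram_unit Uq; rewrite GA unitmx_mul => /andP[].
have AGA : A^T *m \adj (gram q) *m A = (\det (gram q))%:M.
  have : A *m (A^T *m \adj (gram q) *m A) = A *m (\det (gram q))%:M.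
    by rewrite !mulmxA -GA mul_mx_adj mul_scalar_mx mul_mx_scalar.
  by move=> /(congr1 (mulmx (invmx A))); rewrite !mulKmx.
have EA a : E (eps a) q = \sum_i A a i *: f i.
  rewrite [LHS](orthonormal_expansion (inner_form q) _ of_).
  by apply: eq_bigr => i _; rewrite mxE.
have C a b : curv_fun (eps a) c (eps b) d q
  = \sum_i \sum_j A a i * A b j * curv4 nabla q (f i) (E c q) (f j) (E d q).
  rewrite /curv_fun EA (linear_form_comb (ct_linear (T q) _ _ _)).
  apply: eq_bigr => i _; rewrite EA (linear_form_comb (ct_linear3 (T q) _ _ _)) mulr_sumr.
  by apply: eq_bigr => j _; rewrite mulrA.
transitivity (\sum_i \sum_j (A^T *m \adj (gram q) *m A) i j
   * curv4 nabla q (f i) (E c q) (f j) (E d q)).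
  pose X a b i j := \adj (gram q) a b *
    (A a i * A b j * curv4 nabla q (f i) (E c q) (f j) (E d q)).
  transitivity (\sum_a \sum_b \sum_i \sum_j X a b i j).
    apply: eq_bigr => a _; apply: eq_bigr => b _; rewrite C mulr_sumr.
    by apply: eq_bigr => i _; rewrite mulr_sumr.
  transitivity (\sum_i \sum_j \sum_b \sum_a X a b i j); last first.
    apply: eq_bigr => i _; apply: eq_bigr => j _; rewrite [in RHS]mxE mulr_suml.
    apply: eq_bigr => b _; rewrite [in RHS]mxE !mulr_suml.
    by apply: eq_bigr => a _; rewrite /X [A^T _ _]mxE; ring.
  clearbody X.
  have ex (Y : 'I_m -> 'I_m -> R) : \sum_a \sum_b Y a b = \sum_b \sum_a Y a b.
    exact: exchange_big.
  under eq_bigr => a _ do rewrite ex.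
  rewrite ex; apply: eq_bigr => i _.
  under eq_bigr => a _ do rewrite ex.
  by rewrite ex; apply: eq_bigr => j _; rewrite ex.
rewrite AGA.
transitivity (\det (gram q) * ricci_sum (curv4 nabla q) f (E c q) (E d q)).
  rewrite mulr_sumr; apply: eq_bigr => i _; rewrite (bigD1 i) //= big1 ?addr0.
    by rewrite !mxE eqxx mulr1n.
  by move=> j ji; rewrite !mxE eq_sym (negbTE ji) mul0r.
by rewrite (lamP _ _ of_); ring.
Qed.

Lemma gram_diff a b : diff_at (fun q => gram q a b) p.
Proof.
rewrite (_ : (fun q => _) = fun q => inner q (E (eps a) q) (E (eps b) q)).
  exact: smooth_fun_diff_at (inner_smooth oU (sE _) (sE _)) Up.
by apply/funext => q; rewrite mxE.
Qed.

Lemma gram_center : gram p = 1%:M.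
Proof. by apply/matrixP => a b; rewrite !mxE !coord_vfield_center oeps. Qed.

(** On the diagonal [einstein_frame] exhibits [lam] as a quotient of
    differentiable functions. *)
Lemma lam_diff : (0 < m)%N -> diff_at lam p.
Proof.
move=> m0; pose c := eps (Ordinal m0).
pose N q := \sum_a \sum_b \adj (gram q) a b * curv_fun (eps a) c (eps b) c q.
pose D q := \det (gram q) * inner q (E c q) (E c q).
have dD : diff_at D p.
  apply: diff_atM; first by apply: diff_at_det; exact: gram_diff.
  exact: smooth_fun_diff_at (inner_smooth oU (sE _) (sE _)) Up.
have dN : diff_at N p.
  apply: diff_at_sum => a; apply: diff_at_sum => b; apply: diff_atM.
    by apply: diff_at_adj; exact: gram_diff.
  exact: curv_fun_diff.
have c0 q : U q -> inner q (E c q) (E c q) != 0.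
  move=> Uq; rewrite gt_eqF //; apply: inner_pos; apply/eqP => E0.
  have c0 : c = 0.
    have qq := chart_dom_center q.
    by rewrite -(chart_changeK c Uq qq) -[chart_change p q q c]/(E c q) E0
      /chart_change linear0.
  have := oeps (Ordinal m0) (Ordinal m0); rewrite eqxx -/c c0.
  by rewrite (linear_form0 (inner_form p _)) => /eqP; rewrite eq_sym oner_eq0.
have D0 q : U q -> D q != 0.
  by move=> Uq; rewrite mulf_neq0 ?c0 // -unitfE -unitmxE gram_unit.
have H q : U q -> (-1) * (N q * (D q)^-1) = lam q.
  by move=> Uq; rewrite /N einstein_frame // -/(D q) mulN1r -mulNr opprK mulfK // D0.
apply: (proj1 (vderiv_at_local oU Up H _)).
apply: diff_atM; first exact: diff_at_cst.
by apply: diff_atM => //; apply: diff_atV => //; exact: D0.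
Qed.

Variable k : 'rV[R]_m.
Local Notation d h := (vderiv (E k) h p).

(** Differentiate [gram q *m \adj (gram q) = (\det (gram q))%:M] at [p], where
    the Gram matrix and its adjugate are the identity. *)
Lemma adj_deriv a b : d (fun q => \adj (gram q) a b)
  = (a == b)%:R * d (fun q => \det (gram q)) - d (fun q => gram q a b).
Proof.
have dA i j : diff_at (fun q => \adj (gram q) i j) p.
  by apply: diff_at_adj; exact: gram_diff.
have dd : diff_at (fun q => \det (gram q)) p by apply: diff_at_det; exact: gram_diff.
have A1 i j : \adj (gram p) i j = (i == j)%:R.
  have := mul_mx_adj (gram p); rewrite gram_center mul1mx => ->.
  by rewrite det1 mxE.
have H : d (fun q => \sum_i gram q a i * \adj (gram q) i b)
       = d (fun q => (a == b)%:R * \det (gram q)).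
  congr (vderiv _ _ _); apply/funext => q.
  have -> : (a == b)%:R * \det (gram q) = (gram q *m \adj (gram q)) a b.
    by rewrite mul_mx_adj mxE mulr_natl.
  by rewrite [in RHS]mxE.
move: H; rewrite vderiv_atZ // vderiv_at_sum; last first.
  by move=> i; apply: diff_atM => //; exact: gram_diff.
move=> <-.
have Ei i : d (fun q => gram q a i * \adj (gram q) i b)
   = (a == i)%:R * d (fun q => \adj (gram q) i b)
     + (i == b)%:R * d (fun q => gram q a i).
  have V := vderiv_atM (E k) (gram_diff a i) (dA i b).
  apply: (etrans V).
  by congr (_ * _ + _ * _); [rewrite gram_center mxE|exact: A1].
rewrite (eq_bigr _ (fun i _ => Ei i)) big_split /=.
rewrite (sum_delta_r a (fun i => d (fun q => \adj (gram q) i b))).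
rewrite (sum_delta_l b (fun i => d (fun q => gram q a i))).
by rewrite addrK.
Qed.

(** The derivative of [einstein_frame] at [p].  The derivative of the
    determinant drops out by the Einstein condition at [p] itself, and the
    derivatives of the Gram matrix are the Christoffel corrections in [dcurv]. *)
Lemma dcurv_trace c d' : (0 < m)%N ->
  \sum_a dcurv nabla p k (eps a) (eps c) (eps a) (eps d')
  = - ((c == d')%:R * d lam).
Proof.
move=> m0.
have dA i j : diff_at (fun q => \adj (gram q) i j) p.
  by apply: diff_at_adj; exact: gram_diff.
have dd : diff_at (fun q => \det (gram q)) p by apply: diff_at_det; exact: gram_diff.
have dI : diff_at (fun q => inner q (E (eps c) q) (E (eps d') q)) p.
  exact: smooth_fun_diff_at (inner_smooth oU (sE _) (sE _)) Up.
have dl := lam_diff m0.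
have dC a b : diff_at (curv_fun (eps a) (eps c) (eps b) (eps d')) p by
  exact: curv_fun_diff.
have A1 i j : \adj (gram p) i j = (i == j)%:R.
  have := mul_mx_adj (gram p); rewrite gram_center mul1mx => ->.
  by rewrite det1 mxE.
have CE i j l z : curv_fun i j l z p = curv4 nabla p i j l z.
  by rewrite /curv_fun !coord_vfield_center.
pose r a b := curv4 nabla p (eps a) (eps c) (eps b) (eps d').
pose dG a b := d (fun q => gram q a b).
have dGE a b : dG a b
   = inner p (gamma k (eps a)) (eps b) + inner p (eps a) (gamma k (eps b)).
  rewrite -(vderiv_inner LC); congr (vderiv _ _ _).
  by apply/funext => q; rewrite mxE.
have Ric w z : \sum_a curv4 nabla p (eps a) w (eps a) z = - (lam p * inner p w z).
  exact: (lamP w z oeps).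
pose trG q := \sum_a \sum_b
  \adj (gram q) a b * curv_fun (eps a) (eps c) (eps b) (eps d') q.
have H : d trG
   = d (fun q => (-1) * (lam q * (\det (gram q) *
       inner q (E (eps c) q) (E (eps d') q)))).
  have dh : diff_at trG p.
    by apply: diff_at_sum => a; apply: diff_at_sum => b; apply: diff_atM.
  apply: esym; apply: (proj2 (vderiv_at_local oU Up _ dh)) => q Uq.
  by rewrite /trG einstein_frame // mulN1r.
have HL : d trG
   = \sum_a d (curv_fun (eps a) (eps c) (eps a) (eps d'))
     + d (fun q => \det (gram q)) * - (lam p * (c == d')%:R)
     - \sum_a \sum_b dG a b * r a b.
  rewrite vderiv_at_sum; last by move=> a; apply: diff_at_sum => b; exact: diff_atM.
  transitivity (\sum_a (d (curv_fun (eps a) (eps c) (eps a) (eps d'))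
     + d (fun q => \det (gram q)) * r a a - \sum_b dG a b * r a b)).
    apply: eq_bigr => a _; rewrite vderiv_at_sum; last by move=> b; exact: diff_atM.
    transitivity (\sum_b ((a == b)%:R * d (curv_fun (eps a) (eps c) (eps b) (eps d'))
      + (a == b)%:R * (d (fun q => \det (gram q)) * r a b) - dG a b * r a b)).
      apply: eq_bigr => b _; apply: (etrans (vderiv_atM (E k) (dA a b) (dC a b))).
      transitivity ((a == b)%:R * d (curv_fun (eps a) (eps c) (eps b) (eps d'))
         + r a b * ((a == b)%:R * d (fun q => \det (gram q)) - dG a b)).
        by congr (_ * _ + _ * _); [exact: A1|exact: CE|exact: adj_deriv].
      move: (d _) (d _) (r a b) (dG a b) ((a == b)%:R : R) => x1 x2 x3 x4 x5.
      ring.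
    by rewrite sumrB big_split /= !sum_delta_r.
  rewrite sumrB big_split /=; congr (_ + _ - _).
  by rewrite -mulr_sumr /r Ric oeps.
have HR : d (fun q => (-1) * (lam q * (\det (gram q) *
       inner q (E (eps c) q) (E (eps d') q))))
   = - ((c == d')%:R * d lam + lam p * ((c == d')%:R * d (fun q => \det (gram q))
      + (inner p (gamma k (eps c)) (eps d') + inner p (eps c) (gamma k (eps d'))))).
  rewrite vderiv_atZ; last by do 2 apply: diff_atM => //.
  rewrite vderiv_atM //; last exact: diff_atM.
  rewrite vderiv_atM // gram_center det1 !coord_vfield_center oeps (vderiv_inner LC).
  move: (d lam) (d (fun q => \det (gram q))) (lam p) ((c == d')%:R : R)
    (inner p (gamma k (eps c)) _) (inner p _ (gamma k (eps d'))) => x1 x2 x3 x4 x5 x6.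
  ring.
(* Corrections in the traced slots give the derivative of the Gram matrix;
   those in the free slots are Ricci traces at [p]. *)
have HS : \sum_a dcurv nabla p k (eps a) (eps c) (eps a) (eps d')
   = \sum_a d (curv_fun (eps a) (eps c) (eps a) (eps d'))
     - \sum_a \sum_b dG a b * r a b
     + lam p * (inner p (gamma k (eps c)) (eps d') + inner p (eps c) (gamma k (eps d'))).
  (* Expanding [gamma k (eps a)] in the orthonormal basis symmetrizes the
     coefficients into derivatives of the Gram matrix. *)
  have S1 : \sum_a (curv4 nabla p (gamma k (eps a)) (eps c) (eps a) (eps d')
       + curv4 nabla p (eps a) (eps c) (gamma k (eps a)) (eps d'))
     = \sum_a \sum_b dG a b * r a b.
    have X a : gamma k (eps a) = \sum_b inner p (gamma k (eps a)) (eps b) *: eps b.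
      exact: (orthonormal_expansion (inner_form p) _ oeps).
    rewrite big_split /=.
    under eq_bigr => a _ do rewrite {1}X (linear_form_comb (ct_linear (T p) _ _ _)).
    under [X in _ + X = _]eq_bigr => a _ do
      rewrite {1}X (linear_form_comb (ct_linear3 (T p) _ _ _)).
    rewrite exchange_big -big_split /=; apply: eq_bigr => a _.
    rewrite -big_split; apply: eq_bigr => b _ /=.
    by rewrite dGE -/(r a b) mulrDl addrC (inner_sym p (eps a)).
  have -> : \sum_a dcurv nabla p k (eps a) (eps c) (eps a) (eps d')
   = \sum_a d (curv_fun (eps a) (eps c) (eps a) (eps d'))
     - \sum_a (curv4 nabla p (gamma k (eps a)) (eps c) (eps a) (eps d')
       + curv4 nabla p (eps a) (eps c) (gamma k (eps a)) (eps d'))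
     - \sum_a curv4 nabla p (eps a) (gamma k (eps c)) (eps a) (eps d')
     - \sum_a curv4 nabla p (eps a) (eps c) (eps a) (gamma k (eps d')).
    rewrite -!sumrB; apply: eq_bigr => a _; rewrite /dcurv; ring.
  rewrite S1 !Ric; ring.
rewrite HS; move: H; rewrite HL HR.
move: (\sum_a d _) (\sum_a \sum_b _) (d lam) (d (fun q => \det (gram q))) (lam p)
  ((c == d')%:R : R) (inner p (gamma k (eps c)) _) (inner p _ (gamma k (eps d'))).
by clear HL HR HS => x1 x2 x3 x4 x5 x6 x7 x8 H; lra.
Qed.

End schur_at_point.

(** * Schur's lemma for the Ricci tensor *)

Section schur.
Context {R : realType} {m : nat} {M : riemannian R m}.
Variable nabla : vfield M -> vfield M -> vfield M.
Hypothesis LC : levi_civita nabla.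
Variable lam : M -> R.
Hypothesis lamP : forall q e w z, orthonormal_basis q e ->
  ricci_sum (curv4 nabla q) e w z = - (lam q * inner q w z).
Hypothesis m2 : (2 < m)%N.

(** Sum the second Bianchi identity for the indices [(k, a, c; a, k)] over [a]
    and [k].  By the symmetries, two of the three double sums are [- d_c lam]
    and the third is [m * d_c lam]. *)
Lemma schur_frame (p : M) eps c : orthonormal_basis p eps ->
  vderiv (coord_vfield p (eps c)) lam p = 0.
Proof.
move=> oeps; have m0 : (0 < m)%N by exact: leq_trans m2.
pose D k := vderiv (coord_vfield p (eps k)) lam p.
pose S k i j l z := dcurv nabla p (eps k) (eps i) (eps j) (eps l) (eps z).
have T k c1 d : \sum_a S k a c1 a d = - ((c1 == d)%:R * D k).
  exact: (dcurv_trace LC lamP oeps (eps k) c1 d m0).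
have A12 k i j l z : S k i j l z = - S k j i l z by exact: dcurv_anti12.
have A34 k i j l z : S k i j l z = - S k i j z l by exact: dcurv_anti34.
have P k i j l z : S k i j l z = S k l z i j by exact: dcurv_pair.
have B k a : S k a c a k + S a c k a k + S c k a a k = 0 by exact: second_bianchi.
rewrite -/(D c); clearbody S D.
have : \sum_k \sum_a (S k a c a k + S a c k a k + S c k a a k) = 0.
  by apply: big1 => k _; apply: big1 => a _.
under eq_bigr => k _ do rewrite !big_split /=.
rewrite !big_split /=.
have -> : \sum_k \sum_a S k a c a k = - D c.
  under eq_bigr => k _ do rewrite T.
  by rewrite sumrN sum_delta_r.
(* Reordered by the symmetries, this is [S a k a k c], a trace over [k]. *)
have -> : \sum_k \sum_a S a c k a k = - D c.
  rewrite exchange_big /=.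
  under eq_bigr => a _ do under eq_bigr => k _ do rewrite P A12 A34 opprK.
  under eq_bigr => a _ do rewrite T.
  by rewrite sumrN sum_delta_l.
have -> : \sum_k \sum_a S c k a a k = m%:R * D c.
  rewrite exchange_big /=.
  under eq_bigr => a _ do under eq_bigr => k _ do rewrite A34.
  under eq_bigr => a _ do rewrite sumrN T eqxx mul1r opprK.
  by rewrite sumr_const card_ord mulr_natl.
move=> H; have : (m%:R - 2) * D c = 0 by rewrite -H; ring.
by move/eqP; rewrite mulf_eq0 subr_eq0 eqr_nat (gtn_eqF m2) => /eqP.
Qed.

Lemma schur_diff0 (p : M) (v : 'rV[R]_m) :
  'd (lam \o chart_inv p) (chart p p) v = 0.
Proof.
have [e oe] := exists_orthonormal (inner_form p) (inner_sym p) (inner_pos p).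
rewrite (orthonormal_expansion (inner_form p) v oe) linear_sum big1 // => i _.
rewrite linearZ -[X in 'd _ _ X](coord_vfield_center p (e i)).
have -> : 'd (lam \o chart_inv p) (chart p p) (coord_vfield p (e i) p) = 0.
  exact: (schur_frame i oe).
exact: mulr0.
Qed.

(** The differential of [lam] vanishes at the centre of every preferred chart,
    hence, changing charts, throughout the chart at [p]. *)
Lemma schur_locally_constant (p : M) : \forall q \near p, lam q = lam p.
Proof.
have pp := chart_dom_center p.
have m0 : (0 < m)%N by exact: leq_trans m2.
have dl (q : M) : diff_at lam q.
  have [e oe] := exists_orthonormal (inner_form q) (inner_sym q) (inner_pos q).
  exact: (lam_diff LC lamP oe m0).
have /nbhs_ballP[r /= r0 rB] := chart_image_near pp openT I.
have near1 : nbhs p (chart p @^-1` ball (chart p p) r).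
  by apply: (chart_continuous pp); exact: nbhsx_ballx.
have near2 : nbhs p (chart_dom p).
  by apply: open_nbhs_nbhs; split => //; exact: chart_dom_open.
have D y v : ball (chart p p) r y -> differentiable (lam \o chart_inv p) y /\
    'd (lam \o chart_inv p) y v = 0.
  move=> /rB[q [pq _] <-].
  have [d1 e1] := diff_chart_swap v pq (chart_dom_center q) (dl q).
  by split=> //; rewrite [LHS]e1; exact: schur_diff0.
apply: filterS (filterI near1 near2) => q [rq pq].
have D1 y : ball (chart p p) r y -> differentiable (lam \o chart_inv p) y.
  by move=> /(D y 0)[].
have D2 y v : ball (chart p p) r y -> 'D_v (lam \o chart_inv p) y = 0.
  by move=> /(D y v)[dy e0]; rewrite deriveE.
have := derive0_cst D1 D2 rq; rewrite /= !chartK //; exact.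
Qed.

(** A level set of a locally constant function is open and closed. *)
Lemma schur : connected [set: M] -> forall p q, lam p = lam q.
Proof.
move=> cM p q; pose B := [set x | lam x = lam q].
have oB : open B.
  rewrite openE => x Bx; rewrite /interior.
  by apply: filterS (schur_locally_constant x) => y; rewrite /B /= => ->.
have cB : closed B.
  rewrite -openC openE => x Bx; rewrite /interior.
  by apply: filterS (schur_locally_constant x) => y; rewrite /B /= => ->.
have : B = [set: M].
  apply: cM; first by exists q.
    by exists B => //; rewrite setTI.
  by exists B => //; rewrite setTI.
by move=> BT; have : B p by rewrite BT.
Qed.

End schur.

(** * Special and very special submanifolds *)

Section consequences_of_schur.
Context {R : realType} {m : nat} {M : riemannian R m}.
Variable nabla : vfield M -> vfield M -> vfield M.
Hypothesis LC : levi_civita nabla.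
Hypothesis m2 : (2 < m)%N.
Hypothesis cM : connected [set: M].
Let T q : curvature_tensor (curv4 nabla q) := curv4_tensor LC q.

Lemma ricci_sumE (q : M) (e : 'I_m -> 'rV[R]_m) w z :
  inner q (\sum_(i < m) curv nabla q (e i) w (e i)) z
  = ricci_sum (curv4 nabla q) e w z.
Proof. exact: linear_form_sum (inner_form q z) _ _. Qed.

(** Schur's lemma makes the pointwise Einstein factors agree. *)
Lemma einstein_global :
  (forall q e j k, orthonormal_basis q e -> j != k ->
    ricci_sum (curv4 nabla q) e (e j) (e k) = 0) ->
  exists rho : R, forall q e w z, orthonormal_basis q e ->
    ricci_sum (curv4 nabla q) e w z = - (rho * inner q w z).
Proof.
move=> H; have m0 : (0 < m)%N by exact: leq_trans m2.
have E q : exists rho : R, forall e w z, orthonormal_basis q e ->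
    ricci_sum (curv4 nabla q) e w z = - (rho * inner q w z).
  have Hq e j k : orthonormal_family (inner q) e -> j != k ->
      ricci_sum (curv4 nabla q) e (e j) (e k) = 0 by exact: H.
  exact: (einstein_of_offdiag (inner_form q) (inner_sym q) (inner_pos q) (T q) m0 Hq).
have [lam lamP] := choice E.
have [[p _]|nM] := pselect (exists p : M, True).
  by exists (lam p) => q e w z oe; rewrite (schur LC lamP m2 cM p q) lamP.
by exists 0 => q; exfalso; apply: nM; exists q.
Qed.

Lemma einstein_of_offdiag_ricci :
  (forall q e j k, orthonormal_basis q e -> j != k ->
    ricci_sum (curv4 nabla q) e (e j) (e k) = 0) -> einstein nabla.
Proof.
move=> /einstein_global[rho H]; exists rho => q e oe w eta.
by rewrite ricci_sumE H.
Qed.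

(** The Ricci factor is constant by Schur's lemma, and all sectional
    curvatures at a point are this factor divided by [m - 1]. *)
Lemma constant_curvature_of_triples :
  (forall q e i j k, orthonormal_basis q e -> i != j -> i != k -> j != k ->
    curv4 nabla q (e i) (e j) (e i) (e k) = 0) ->
  constant_sectional_curvature nabla.
Proof.
move=> H; have [|rho Hrho] := einstein_global.
  by move=> q e j k oe jk; apply: (offdiag_of_triples (T q) (H q) oe jk).
exists (rho / (m.-1)%:R) => q.
apply: (sectional_of_planes (inner_form q) (inner_sym q) (inner_pos q) (T q)).
move=> e i j oe ij.
exact: (sectional_of_triples (inner_form q) (inner_sym q) (T q) (H q) (ltnW m2)
  (Hrho q) oe ij).
Qed.

Section span_of_frame.
Variables (q : M) (e : 'I_m -> 'rV[R]_m) (A : {set 'I_m}).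
Hypothesis oe : orthonormal_basis q e.

Definition frame_tuple : #|A|.-tuple 'rV[R]_m := [tuple e (enum_val i) | i < #|A|].
Definition frame_span : {vspace 'rV[R]_m} := <<frame_tuple>>%VS.

Let nthE (i : 'I_#|A|) : frame_tuple`_i = e (enum_val i).
Proof. by rewrite -tnth_nth tnth_mktuple. Qed.

Lemma dim_frame_span : \dim frame_span = #|A|.
Proof.
suff /eqP -> : free frame_tuple by rewrite size_tuple.
apply/freeP => c c0 i.
have := linear_form0 (inner_form q (e (enum_val i))).
rewrite -c0 (linear_form_comb (inner_form q _)) => <-.
rewrite -[LHS](sum_delta_l i); apply: eq_bigr => j _.
by rewrite nthE oe (inj_eq enum_val_inj) mulrC.
Qed.

Lemma mem_frame_span i : i \in A -> e i \in frame_span.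
Proof.
move=> iA; apply: memv_span; apply/tnthP; exists (enum_rank_in iA i).
by rewrite tnth_mktuple enum_rankK_in.
Qed.

Lemma frame_span_normal w k : w \in frame_span -> k \notin A -> inner q w (e k) = 0.
Proof.
move=> wW kA; rewrite (coord_span wW) (linear_form_comb (inner_form q _)).
apply: big1 => i _; rewrite nthE oe (_ : (_ == _) = false) ?mulr0 //.
by apply/eqP => ik; move: kA; rewrite -ik enum_valP.
Qed.

End span_of_frame.

(** An isometric immersion preserves inner products, so the preimages of the
    frame vectors indexed by [A] form an orthonormal basis of the tangent space
    of the submanifold. *)
Lemma axiom_special_sums r q e (A : {set 'I_m}) j k :
  axiom_special nabla r -> orthonormal_basis q e -> #|A| = r -> j \in A ->
  k \notin A -> \sum_(i in A) curv4 nabla q (e i) (e j) (e i) (e k) = 0.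
Proof.
move=> ax oe cA jA kA.
have [|S [f [s [[[_ _ iso] _] spec fs rf]]]] := ax q (frame_span e A).
  by rewrite (dim_frame_span A oe).
(* [f s] replaces the base point and [#|A|] the dimension, since [S], [f] and
   the metric depend on them. *)
case: _ / fs oe rf => oe rf; case: _ / cA S f s iso spec oe rf.
move=> S f s iso spec oe rf.
have pre i : i \in A -> exists v, dmap f s v = e i.
  move=> iA; have : range (dmap f s) (e i) by rewrite rf /=; exact: mem_frame_span.
  by move=> [v _ <-]; exists v.
have [v ve] := choice (fun i : 'I_#|A| => pre _ (enum_valP i)).
have [w we] := pre j jA.
have ov : orthonormal_basis s v.
  by move=> a b; rewrite -iso !ve oe (inj_eq enum_val_inj).
have := spec s v ov w; rewrite rf /= we => /(frame_span_normal oe)/(_ kA).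
rewrite (linear_form_sum (inner_form _ _)) => H; rewrite -[RHS]H big_enum_val.
by apply: eq_bigr => a _; rewrite ve.
Qed.

(** Both [e i] and [e j] are tangent to a very special hypersurface with normal
    [e k]. *)
Lemma axiom_very_special_triples q e i j k : axiom_very_special nabla (m - 1) ->
  orthonormal_basis q e -> i != k -> j != k ->
  curv4 nabla q (e i) (e j) (e i) (e k) = 0.
Proof.
move=> ax oe ik jk; pose A : {set 'I_m} := ~: [set k]%SET.
have cA : #|A| = (m - 1)%N by rewrite cardsC1 card_ord subn1.
have inA l : l != k -> l \in A by move=> lk; rewrite !inE.
have kA : k \notin A by rewrite !inE negbK.
have [|S [f [s [[_ _] spec fs rf]]]] := ax q (frame_span e A).
  by rewrite (dim_frame_span A oe).
case: _ / fs oe rf => oe rf.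
have pre l : l \in A -> exists v, dmap f s v = e l.
  move=> lA; have : range (dmap f s) (e l) by rewrite rf /=; exact: mem_frame_span.
  by move=> [v _ <-]; exists v.
have [v ve] := pre i (inA i ik); have [w we] := pre j (inA j jk).
have := spec s v w; rewrite rf /= ve we => /(frame_span_normal oe)/(_ kA).
exact.
Qed.

Lemma constant_curvature_of_axiom_special r : (2 <= r)%N -> (r <= m - 2)%N ->
  axiom_special nabla r -> constant_sectional_curvature nabla.
Proof.
move=> r2 rm ax; apply: constant_curvature_of_triples => q e i j k oe ij ik jk.
apply: (exchange_sums
  (x := fun i => curv4 nabla q (e i) (e j) (e i) (e k)) r2 rm jk) => //.
  exact: ct_diag12 (T q) _ _ _.
by move=> A cA jA kA; exact: axiom_special_sums ax oe cA jA kA.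
Qed.

Lemma einstein_of_axiom_special : axiom_special nabla (m - 1) -> einstein nabla.
Proof.
move=> ax; apply: einstein_of_offdiag_ricci => q e j k oe jk.
have cA : #|~: [set k]%SET| = (m - 1)%N by rewrite cardsC1 card_ord subn1.
rewrite /ricci_sum (bigD1 k) //= (ct_diag34 (T q)) add0r.
rewrite -[RHS](axiom_special_sums ax oe cA (j := j) (k := k)) ?inE ?negbK //.
by apply: eq_bigl => i; rewrite !inE.
Qed.

End consequences_of_schur.

Section converse.
Context {R : realType}.

(** The curvature vector is a combination of the two tangent vectors it is
    built from. *)
Lemma constant_curvature_very_special n m (S : riemannian R n) (M : riemannian R m)
    (nabla : vfield M -> vfield M -> vfield M) (f : S -> M) :
  levi_civita nabla -> constant_sectional_curvature nabla -> very_special nabla f.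
Proof.
move=> LC [c Hc] s v w; set q := f s.
have H := curvature_of_sectional (inner_form q) (inner_sym q) (inner_pos q)
  (curv4_tensor LC q) (Hc q).
set v' := dmap f s v; set w' := dmap f s w.
exists ((- (c * inner q v' v')) *: w + (c * inner q w' v') *: v) => //.
have -> : dmap f s ((- (c * inner q v' v')) *: w + (c * inner q w' v') *: v)
    = (- (c * inner q v' v')) *: w' + (c * inner q w' v') *: v'.
  by rewrite /dmap linearD !linearZ.
apply: (nondegenerate (q := q)) => z.
rewrite inner_linear (linear_formZ (inner_form q z)).
have -> : inner q (curv nabla q v' w' v') z = curv4 nabla q v' w' v' z by [].
rewrite (curv4_anti12 LC) H; ring.
Qed.

(** A vector is tangent as soon as it is orthogonal to the unit normal.  The
    full Ricci trace is a multiple of a tangent vector, and its normal summand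
    [R(N, w) N] is orthogonal to [N]. *)
Lemma einstein_hypersurface_special n (S : riemannian R n) (M : riemannian R n.+1)
    (nabla : vfield M -> vfield M -> vfield M) (f : S -> M) :
  levi_civita nabla -> einstein nabla -> isometric_immersion f ->
  special nabla f.
Proof.
move=> LC [rho Hrho] [_ _ iso] s e oe w; set q := f s.
pose fe (i : nat) : 'rV[R]_n.+1 :=
  if insub i is Some j then dmap f s (e j) else 0.
have feE (i : 'I_n) : fe i = dmap f s (e i) by rewrite /fe valK.
have ofe i j : (i < n)%N -> (j < n)%N -> inner q (fe i) (fe j) = (i == j)%:R.
  move=> ilt jlt; rewrite -[i]/(val (Ordinal ilt)) -[j]/(val (Ordinal jlt)) !feE iso oe.
  by [].
have [h oh hE] := orthonormal_extension (inner_form q) (inner_sym q) (inner_pos q)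
  (leqnSn n) ofe.
have hw (i : 'I_n) : h (widen_ord (leqnSn n) i) = dmap f s (e i).
  by rewrite hE //= feE.
set N := h ord_max.
have orth x : inner q (dmap f s x) N = 0.
  rewrite (orthonormal_expansion (inner_form s) x oe) /dmap linear_sum.
  rewrite (linear_form_sum (inner_form q N)) big1 // => i _.
  rewrite linearZ (linear_formZ (inner_form q N)) -/(dmap f s (e i)) -hw oh.
  by rewrite (_ : (_ == _) = false) ?mulr0 //; apply/eqP => /(congr1 val) /= ni;
    have := ltn_ord i; rewrite ni ltnn.
set X := \sum_(i < n) _.
have XN : inner q X N = 0.
  have := Hrho q h oh (dmap f s w) N; rewrite orth mulr0 oppr0 big_ord_recr /=.
  rewrite (linear_formD (inner_form q N)) -/N.
  have -> : inner q (curv nabla q N (dmap f s w) N) N = 0.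
    exact: (ct_diag34 (curv4_tensor LC q)).
  rewrite addr0 => ->; congr (inner q _ N); apply: eq_bigr => i _.
  by rewrite hw.
exists (\sum_(i < n) inner q X (dmap f s (e i)) *: e i) => //.
rewrite [RHS](orthonormal_expansion (inner_form q) X oh) big_ord_recr /= XN.
rewrite scale0r addr0 /dmap linear_sum; apply: eq_bigr => i _.
by rewrite linearZ hw.
Qed.

End converse.

Theorem theorem1p1 (R : realType) :
  (forall (m : nat) (M : riemannian R m)
     (nabla : vfield M -> vfield M -> vfield M),
     (3 <= m)%N -> connected [set: M] -> levi_civita nabla ->
     (forall r : nat, (2 <= r)%N -> (r <= m - 1)%N ->
        axiom_special nabla r ->
        ((r <= m - 2)%N -> constant_sectional_curvature nabla) /\
        (r = (m - 1)%N -> einstein nabla)) /\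
     (axiom_very_special nabla (m - 1) -> constant_sectional_curvature nabla))
  /\
  (forall (n m : nat) (S : riemannian R n) (M : riemannian R m)
     (nabla : vfield M -> vfield M -> vfield M) (f : S -> M),
     levi_civita nabla -> constant_sectional_curvature nabla ->
     isometric_immersion f -> very_special nabla f)
  /\
  (forall (n : nat) (S : riemannian R n) (M : riemannian R n.+1)
     (nabla : vfield M -> vfield M -> vfield M) (f : S -> M),
     levi_civita nabla -> einstein nabla ->
     isometric_immersion f -> special nabla f).
Proof.
split; last split.
- move=> m M nabla m3 cM LC; split=> [r r2 _ ax|ax].
    split=> [rm|rm]; first exact: (constant_curvature_of_axiom_special LC m3 cM r2 rm ax).
    by rewrite rm in ax; exact: (einstein_of_axiom_special LC m3 cM ax).
  apply: (constant_curvature_of_triples LC m3 cM) => q e i j k oe ij ik jk.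
  exact: (axiom_very_special_triples ax oe ik jk).
- by move=> n m S M nabla f LC K _; exact: (constant_curvature_very_special f LC K).
- by move=> n S M nabla f LC Ei iso; exact: (einstein_hypersurface_special LC Ei iso).
Qed.
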